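(* Let $M$ be a smooth manifold, let $B\in\Gamma(\mathrm{T}^*M\otimes \mathrm{T}^*M)$ be a non-degenerate 2-covariant tensor field, and let $\omega$ and $S$ denote, respectively, its skew-symmetric and symmetric parts. Assume that $\mathrm{T}M=\mathcal H\oplus\mathcal V$, with $\mathcal H=\operatorname{Ker}S$ and $\mathcal V=\operatorname{Ker}\omega$ vector subbundles. Then, for any vector fields $X,Y,Z\in\mathfrak X(M)$, $$\tfrac12\llbracket\omega,\omega\rrbracket(X,Y,Z)=\mathrm d\omega(X_{\mathcal H},Y_{\mathcal H},Z_{\mathcal H})+S([X_{\mathcal H},Y_{\mathcal H}],Z_{\mathcal V})+S([Y_{\mathcal H},Z_{\mathcal H}],X_{\mathcal V})+S([Z_{\mathcal H},X_{\mathcal H}],Y_{\mathcal V}),$$ where $\llbracket\cdot,\cdot\rrbracket$ is the conjugate Schouten–Nijenhuis bracket associated with $B$.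
   Context: Manifolds are smooth and paracompact, and all objects are smooth. For a 2-covariant tensor field $T$, $\widehat T\colon \mathrm TM\to \mathrm T^*M$ is $\widehat T(v)=T(v,\cdot)$, and ${}^{t}\widehat T(v)=T(\cdot,v)$; $\operatorname{Ker}T$ means $\operatorname{Ker}\widehat T$. $B$ is non-degenerate if $\widehat B$ is an isomorphism. $\omega(u,v)=\frac12(B(u,v)-B(v,u))$, $S(u,v)=\frac12(B(u,v)+B(v,u))$. For a linear bundle map $F$, $\mathsf\Lambda^kF$ is the induced map on $k$-th exterior powers. The exterior algebra uses the determinant convention, e.g. $(\alpha\wedge\beta)(X,Y)=\alpha(X)\beta(Y)-\alpha(Y)\beta(X)$. $X_{\mathcal H},X_{\mathcal V}$ are the components of $X$ along $\mathcal H$ and $\mathcal V$. $[\cdot,\cdot]$ on multivector fields is the Schouten–Nijenhuis bracket, with the sign convention: it extends the Lie bracket of vector fields, $[X,f]=X(f)$ for a vector field $X$ and function $f$, $[P,Q]=-(-1)^{(p-1)(q-1)}[Q,P]$ and $[P,Q\wedge R]=[P,Q]\wedge R+(-1)^{(p-1)q}Q\wedge[P,R]$ for multivector fields of degrees $p,q,r$. The conjugate Schouten–Nijenhuis bracket associated with $B$ is $\llbracket\cdot,\cdot\rrbracket\colon\Omega^a(M)\times\Omega^b(M)\to\Omega^{a+b-1}(M)$, $$\llbracket\alpha,\beta\rrbracket=\mathsf\Lambda^{a+b-1}\,{}^{t}\widehat B\Big(\big[\mathsf\Lambda^{a}\,({}^{t}\widehat B)^{-1}(\alpha),\ \mathsf\Lambda^{b}\,({}^{t}\widehat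 B)^{-1}(\beta)\big]\Big).$$ *)

(* Defs.v *)
From mathcomp Require Export all_boot all_order all_algebra.
From mathcomp Require Export all_classical all_reals all_analysis.
Export Order.TTheory GRing.Theory Num.Theory numFieldNormedType.Exports.

Set Implicit Arguments.
Unset Strict Implicit.
Unset Printing Implicit Defensive.

Local Open Scope classical_set_scope.
Local Open Scope ring_scope.

(** * Smooth maps between open subsets of normed spaces *)

Fixpoint Ck (R : realType) (V W : normedModType R) (k : nat)
    (U : set V) (f : V -> W) : Prop :=
  if k is j.+1 then
    (forall x, U x -> differentiable f x) /\ (forall v, Ck j U (fun x => 'D_v f x))
  else forall x, U x -> {for x, continuous f}.

Definition smooth_on (R : realType) (V W : normedModType R)
    (U : set V) (f : V -> W) : Prop := forall k, Ck k U f.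

(** * Smooth manifolds *)

Definition paracompact (M : topologicalType) : Prop :=
  forall U : set (set M), U `<=` open -> \bigcup_(A in U) A = setT ->
    exists W : set (set M),
      [/\ W `<=` open,
          \bigcup_(A in W) A = setT,
          forall A, W A -> exists2 A', U A' & A `<=` A'
        & forall x : M, exists2 N : set M, nbhs x N &
            finite_set [set A | W A /\ A `&` N !=set0]].

(* [coord c] and [param c] are total functions; only their restrictions to
   [dom c] and to [coord c @` dom c] matter.  [chart_at] picks a chart around
   each point, see below. *)
Record manifold (R : realType) (n : nat) := Manifold {
  carrier :> topologicalType;
  carrier_hausdorff : hausdorff_space carrier;
  carrier_paracompact : paracompact carrier;
  chart : Type;
  dom : chart -> set carrier;
  coord : chart -> carrier -> 'rV[R]_n;
  param : chart -> 'rV[R]_n -> carrier;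
  dom_open : forall c, open (dom c);
  img_open : forall c, open (coord c @` dom c);
  coordK : forall c x, dom c x -> param c (coord c x) = x;
  coord_continuous : forall c, {within dom c, continuous (coord c)};
  param_continuous : forall c, {within coord c @` dom c, continuous (param c)};
  transition_smooth : forall c d,
    smooth_on (coord c @` (dom c `&` dom d)) (coord d \o param c);
  chart_at : carrier -> chart;
  dom_chart_at : forall x, dom (chart_at x) x }.

Arguments dom {R n m} c.
Arguments coord {R n m} c x.
Arguments param {R n m} c y.
Arguments chart_at {R n m} x.

(* The tangent space at [x] is R^n, through the isomorphism with T_x M given by
   the chart [chart_at x].  Tangent vectors at different points are therefore
   read in different charts, and nothing below compares them without first
   passing to a common chart by [tcomp]. *)
Notation tangent R n := 'rV[R]_n (only parsing).

Section Manifold.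
Variables (R : realType) (n : nat) (M : manifold R n).
Implicit Types (c : chart M) (x : M).

(* components in the chart [c] of the tangent vector [v] at [x] *)
Definition tcomp c x (v : tangent R n) : 'rV[R]_n :=
  'D_v (coord c \o param (chart_at x)) (coord (chart_at x) x).

(* the tangent vector at [x] with components [w] in the chart [c] *)
Definition tvec c x (w : 'rV[R]_n) : tangent R n :=
  'D_w (coord (chart_at x) \o param c) (coord c x).

Definition smooth_fun (f : M -> R) : Prop :=
  forall c, smooth_on (coord c @` dom c) (f \o param c).

Definition vfield := M -> tangent R n.

Definition smooth_vfield_on (U : set M) (X : vfield) : Prop :=
  forall c, smooth_on (coord c @` (dom c `&` U))
    (fun y => tcomp c (param c y) (X (param c y))).

Definition smooth_vfield (X : vfield) : Prop := smooth_vfield_on setT X.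

(* X(f) *)
Definition vact (X : vfield) (f : M -> R) : M -> R :=
  fun x => 'D_(X x) (f \o param (chart_at x)) (coord (chart_at x) x).

(* [X, Y]^i = X^j d_j Y^i - Y^j d_j X^i in the chart [chart_at x] *)
Definition lie (X Y : vfield) : vfield := fun x =>
  let c := chart_at x in
  let loc (Z : vfield) y := tcomp c (param c y) (Z (param c y)) in
  'D_(X x) (loc Y) (coord c x) - 'D_(Y x) (loc X) (coord c x).

(* Vector subbundle: smooth local frames exist.  The rank is locally constant. *)
Definition subbundle (E : M -> {vspace (tangent R n)}) : Prop :=
  forall x0 : M, exists (U : set M) (k : nat) (e : 'I_k -> vfield),
    [/\ open U, U x0, forall i, smooth_vfield_on U (e i)
      & forall x, U x -> basis_of (E x) [seq e i x | i <- enum 'I_k]].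

End Manifold.

(** * Exterior algebra of a finite-dimensional space *)

Section Exterior.
Variable R : realType.
Implicit Types V W : vectType R.

Definition dualsp V : vectType R := 'Hom(V, R^o).

(* the canonical isomorphism V -> V^** *)
Definition bidual V : 'Hom(V, dualsp (dualsp V)) :=
  linfun (fun v => linfun (fun b : dualsp V => b v) : dualsp (dualsp V)).

(* Elements of the exterior algebra of [V] are functions of finite lists of
   covectors; those of degree [p] satisfy [exterior p]. *)
Definition ext V := seq (dualsp V) -> R.

Definition exterior V (p : nat) (a : ext V) : Prop :=
  [/\ forall l, size l != p -> a l = 0,
      forall l1 l2 (k : R) (b b' : dualsp V),
        a (l1 ++ (k *: b + b') :: l2) = k * a (l1 ++ b :: l2) + a (l1 ++ b' :: l2)
    & forall l, ~~ uniq l -> a l = 0].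

(* number of pairs i < j with m_i = false and m_j = true *)
Fixpoint shuffle_inv (m : seq bool) : nat :=
  if m is b :: m' then ((if b then 0 else count id m') + shuffle_inv m')%N else 0%N.

(* determinant convention: (a /\ b)(l) is the signed sum over all shuffles, with
   coefficients 1 *)
Definition wedge V (a b : ext V) : ext V := fun l =>
  \sum_(m : (size l).-tuple bool)
    (-1) ^+ shuffle_inv m * a (mask m l) * b (mask (map negb m) l).

(* The map induced by F on exterior powers, in all degrees: it sends
   v1 /\ ... /\ vk to F v1 /\ ... /\ F vk. *)
Definition ext_map V W (F : 'Hom(V, W)) (a : ext V) : ext W :=
  fun l => a [seq (b \o F)%VF | b <- l].

(* Forms on V are elements of the exterior algebra of V^*. *)
Definition form_eval V (a : ext (dualsp V)) (vs : seq V) : R :=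
  a [seq bidual V v | v <- vs].

Definition form_of V (a : seq V -> R) : ext (dualsp V) :=
  fun l => a [seq ((bidual V)^-1)%VF v | v <- l].

(* a bilinear form as an element of degree 2 (meaningful if it is skew) *)
Definition form2 V (w : V -> V -> R) : ext (dualsp V) :=
  form_of (fun vs => if vs is [:: u; v] then w u v else 0).

Definition is_bilinear V (B : V -> V -> R) : Prop :=
  (forall v, scalar (B^~ v)) /\ (forall u, scalar (B u)).

Definition hat V (B : V -> V -> R) : 'Hom(V, dualsp V) :=
  linfun (fun v => linfun (fun u => B v u : R^o) : dualsp V).

Definition hat_tr V (B : V -> V -> R) : 'Hom(V, dualsp V) :=
  linfun (fun v => linfun (fun u => B u v : R^o) : dualsp V).

Definition ker V (B : V -> V -> R) : {vspace V} := lker (hat B).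

Definition skew_part V (B : V -> V -> R) (u v : V) : R := 2^-1 * (B u v - B v u).
Definition sym_part V (B : V -> V -> R) (u v : V) : R := 2^-1 * (B u v + B v u).

End Exterior.

(** * Tensor fields, multivector fields and forms *)

Section Fields.
Variables (R : realType) (n : nat) (M : manifold R n).
Local Notation T := (tangent R n).

(* smooth sections of T^*M (x) T^*M *)
Definition tensor2 (B : M -> T -> T -> R) : Prop :=
  (forall x, is_bilinear (B x)) /\
  (forall (c : chart M) (u v : 'rV[R]_n),
     smooth_on (coord c @` dom c) (fun y : 'rV[R]_n =>
       let x := param c y in B x (tvec c x u) (tvec c x v))).

Definition nondegenerate (B : M -> T -> T -> R) : Prop :=
  forall x, bijective (hat (B x)).

(* the covector dx^i at [x], for the chart [c] *)
Definition dcoord (c : chart M) (x : M) (i : 'I_n) : dualsp T :=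
  linfun (fun v : T => tcomp c x v ord0 i : R^o).

Definition mvfield := M -> ext T.

(* smooth multivector fields of degree p *)
Definition multivector (p : nat) (P : mvfield) : Prop :=
  (forall x, exterior p (P x)) /\
  (forall (c : chart M) (s : seq 'I_n),
     smooth_on (coord c @` dom c) (fun y : 'rV[R]_n =>
       let x := param c y in P x [seq dcoord c x i | i <- s])).

Definition mv_fun (f : M -> R) : mvfield :=
  fun x l => if l is [::] then f x else 0.

Definition mv_vfield (X : vfield M) : mvfield :=
  fun x l => if l is [:: b] then b (X x) else 0.

Definition mv_wedge (P Q : mvfield) : mvfield := fun x => wedge (P x) (Q x).

Definition mv_lin (k : R) (P Q : mvfield) : mvfield :=
  fun x l => k * P x l + Q x l.

Definition mv_sign (e : nat) (P : mvfield) : mvfield :=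
  fun x l => (-1) ^+ e * P x l.

(* The Schouten-Nijenhuis bracket.  Only its values on homogeneous smooth
   multivector fields are constrained.  In the exponents of -1, an occurrence of
   p - 1 is replaced by p + 1, which has the same parity. *)
Record schouten_bracket (br : mvfield -> mvfield -> mvfield) : Prop := {
  sn_degree : forall p q r P Q, multivector p P -> multivector q Q ->
    (p + q = r.+1)%N -> multivector r (br P Q);
  sn_fun_fun : forall f g, smooth_fun f -> smooth_fun g ->
    br (mv_fun f) (mv_fun g) = mv_fun (fun=> 0);
  sn_linl : forall p q k P P' Q,
    multivector p P -> multivector p P' -> multivector q Q ->
    br (mv_lin k P P') Q = mv_lin k (br P Q) (br P' Q);
  sn_linr : forall p q k P Q Q',
    multivector p P -> multivector q Q -> multivector q Q' ->
    br P (mv_lin k Q Q') = mv_lin k (br P Q) (br P Q');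
  sn_lie : forall X Y, smooth_vfield X -> smooth_vfield Y ->
    br (mv_vfield X) (mv_vfield Y) = mv_vfield (lie X Y);
  sn_vact : forall X f, smooth_vfield X -> smooth_fun f ->
    br (mv_vfield X) (mv_fun f) = mv_fun (vact X f);
  sn_antisym : forall p q P Q, multivector p P -> multivector q Q ->
    br P Q = mv_sign (p.+1 * q.+1).+1 (br Q P);
  sn_leibniz : forall p q r P Q S,
    multivector p P -> multivector q Q -> multivector r S ->
    br P (mv_wedge Q S) =
    mv_lin 1 (mv_wedge (br P Q) S) (mv_sign (p.+1 * q) (mv_wedge Q (br P S))) }.

Definition formfield := M -> ext (dualsp T).

(* Exterior derivative, in the chart [chart_at x]:
   d a (u_0, ..., u_k) = sum_i (-1)^i D_{u_i} a (u_0, .. omit u_i .., u_k)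
   where the u_j are extended with constant components. *)
Definition ext_deriv (a : formfield) : formfield := fun x =>
  form_of (fun us : seq T =>
    let c := chart_at x in
    \sum_(i < size us) (-1) ^+ i *
      'D_(nth 0 us i) (fun y : 'rV[R]_n =>
         let z := param c y in
         form_eval (a z) [seq tvec c z u | u <- take i us ++ drop i.+1 us] : R)
      (coord c x)).

(* The conjugate of the bracket [br] by B. *)
Definition conj_bracket (br : mvfield -> mvfield -> mvfield)
    (B : M -> T -> T -> R) (a b : formfield) : formfield := fun x =>
  let sharp (g : formfield) : mvfield := fun z => ext_map ((hat_tr (B z))^-1)%VF (g z) in
  ext_map (hat_tr (B x)) (br (sharp a) (sharp b) x).

End Fields.

(* Main.v *)
From HB Require Import structures.
From mathcomp Require Import ring lra.
Require Import Defs.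

Set Implicit Arguments.
Unset Strict Implicit.
Unset Printing Implicit Defensive.

Local Open Scope classical_set_scope.
Local Open Scope ring_scope.

(** Let [P] be the bivector field with [P(B(u,_), B(v,_)) = omega(u, v)], that is
    the image of [omega] under the inverse of [hat_tr B].  Evaluating the conjugate
    bracket on [X, Y, Z] amounts to evaluating [[P, P]] on the covectors
    [B(X,_)], [B(Y,_)], [B(Z,_)], so the proof is a computation of [[P, P]],
    followed by a change of variables.

    Computing [[P, P]].  In a chart, [P] is half the sum of the [d_i /\ Y_i] where
    [Y_i] is the vector field with components the i-th row of the matrix of [P].
    The bracket is only known on globally defined fields, so this decomposition is
    first multiplied by the square of a smooth function [chi] supported in the chart
    and equal to 1, with zero derivative, at the given point [x0] ([cutoff], built
    from [exp(-1/t)]).  Writing [1 - chi^2 = g h] with [g] and [h] vanishing at [x0],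
    the Leibniz rule shows that the passage from [P] to [chi^2 P] does not change
    [[P, P]] at [x0] ([br_cut]).  The bracket of two decomposable
    bivectors is a combination of Lie brackets ([br_wedge]), and the resulting double
    sum collapses to the Jacobiator ([br_sharp_omega]): [[P, P](a, b, c)] is twice
    the cyclic sum of [(D_{P(a,_)} P)(b, c)].

    Changing variables.  As [V] is the kernel of [omega] and [H] that of [S], the vector
    [P(B(X,_), _)] is [- X_H] ([tcomp_hor]); in particular the horizontal projection
    of a smooth field is smooth.  So every term of the Jacobiator is a derivative
    [- (D_U P)(B(Y,_), B(Z,_))] along [U = X_H].  Differentiating along [U] the three
    expressions [P(B(Y,_), B(Z,_))], [B(Y, Z_H)] and [omega(Y_H, Z_H)] of the same
    function [omega(Y, Z)] expresses this through [(D_U omega)(Y_H, Z_H)] and the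
    derivatives of [Y_H] and [Z_H] ([derive_bivector_split]).  In the cyclic sum the
    former give [d omega], and the latter pair up into the Lie brackets
    [[X_H, Y_H]], which are contracted by [B(Z, _) - omega(Z_H, _) = S(_, Z_V)]
    ([sym_ver]). *)

(** * Calculus of smooth functions *)

Section Calculus.
Variable R : realType.
Implicit Types (V W : normedModType R) (k : nat).

Lemma near_eq_differentiable V W (f g : V -> W) (x : V) :
  (\forall y \near x, f y = g y) -> differentiable f x -> differentiable g x.
Proof.
move=> fg df.
have gE : g \o shift x = cst (g x) + 'd f x +o_ 0 id.
  apply/eqaddoP => _/posnumP[e].
  have /eqaddoP/(_ e%:num (gt0 e)) fE := diff_locally df.
  have : \forall h \near 0, f (h + x) = g (h + x).
    by move: fg; rewrite (near_shift 0 x) subr0.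
  apply: filter_app; move: fE; apply: filter_app; near=> h => /= fE fgh.
  by move: fE; rewrite /= /cst /shift !fctE /= -fgh (nbhs_singleton fg).
apply/diff_locallyP; have -> // : 'd g x = 'd f x :> (V -> W).
  by apply: diff_unique => //; exact: diff_continuous.
by split=> //; exact: diff_continuous.
Unshelve. all: by end_near. Qed.

Lemma Ck_sub V W k (U U' : set V) (f : V -> W) :
  U `<=` U' -> Ck k U' f -> Ck k U f.
Proof.
move=> sUU'; elim: k f => [|k IHk] f /= => [cf x /sUU'|[df Df]]; first exact: cf.
by split=> [x /sUU'|v]; [exact: df|exact: IHk].
Qed.

(** [Ck] is a pointwise condition, which is why the sets [U'] may be arbitrary. *)
Lemma Ck_local V W k (U : set V) (f : V -> W) :
  (forall x, U x -> exists2 U', U' x & Ck k U' f) -> Ck k U f.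
Proof.
elim: k f => [|k IHk] f /= loc; first by move=> x /loc[U' U'x]; apply.
split=> [x /loc[U' U'x [df _]]|v]; first exact: df.
by apply: IHk => x /loc[U' U'x [_ Df]]; exists U'.
Qed.

Lemma Ck_eq V W k (U : set V) (f g : V -> W) :
  open U -> (forall x, U x -> f x = g x) -> Ck k U f -> Ck k U g.
Proof.
move=> oU; elim: k f g => [|k IHk] f g fg.
  move=> cf x Ux; rewrite /prop_for /continuous_at -(fg x Ux); apply: cvg_trans (cf x Ux).
  apply: near_eq_cvg; near=> y; apply: fg; near: y; exact: open_nbhs_nbhs.
move=> [df Df]; split=> [x Ux|v].
  apply: near_eq_differentiable (df x Ux).
  by near=> y; apply: fg; near: y; exact: open_nbhs_nbhs.
apply: IHk (Df v) => x Ux; apply: near_eq_derive.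
by near=> y; apply: fg; near: y; exact: open_nbhs_nbhs.
Unshelve. all: by end_near. Qed.

Lemma CkS V W k (U : set V) (f : V -> W) : Ck k.+1 U f -> Ck k U f.
Proof.
elim: k f => [|k IHk] f [df Df]; last by split=> // v; exact: IHk (Df v).
by move=> x Ux; apply: differentiable_continuous; exact: df.
Qed.

Lemma Ck_cst V W k (U : set V) (a : W) : Ck k U (fun _ : V => a).
Proof.
elim: k a => [|k IHk] a; first by move=> x _; exact: cvg_cst.
split=> [x _|v]; first exact: differentiable_cst.
have -> : (fun x : V => 'D_v (fun _ : V => a) x) = fun=> 0.
  by apply/funext => x; exact: derive_cst.
exact: IHk.
Qed.

Lemma CkD V W k (U : set V) (f g : V -> W) : open U ->
  Ck k U f -> Ck k U g -> Ck k U (fun x => f x + g x).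
Proof.
move=> oU; elim: k f g => [|k IHk] f g.
  by move=> cf cg x Ux; apply: cvgD; [exact: cf|exact: cg].
move=> [df Df] [dg Dg]; split=> [x Ux|v].
  by apply: differentiableD; [exact: df|exact: dg].
apply: Ck_eq (IHk _ _ (Df v) (Dg v)) => // x Ux.
by rewrite deriveD//; apply: diff_derivable; [exact: df|exact: dg].
Qed.

Lemma Ck_sum V W k (U : set V) (I : Type) (r : seq I) (F : I -> V -> W) :
  open U -> (forall i, Ck k U (F i)) -> Ck k U (fun x => \sum_(i <- r) F i x).
Proof.
move=> oU CF; elim: r => [|i r IHr].
  by under eq_fun do rewrite big_nil; exact: Ck_cst.
by under eq_fun do rewrite big_cons; exact: CkD.
Qed.

Lemma CkM V k (U : set V) (f g : V -> R) : open U ->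
  Ck k U f -> Ck k U g -> Ck k U (fun x => f x * g x).
Proof.
move=> oU; elim: k f g => [|k IHk] f g.
  by move=> cf cg x Ux; apply: cvgM; [exact: cf|exact: cg].
move=> Cf Cg; have [[df Df] [dg Dg]] := (Cf, Cg); split=> [x Ux|v].
  by apply: differentiableM; [exact: df|exact: dg].
apply: Ck_eq (CkD oU (IHk _ _ (CkS Cf) (Dg v)) (IHk _ _ (CkS Cg) (Df v))) => // x Ux.
by rewrite [in RHS]deriveM//; apply: diff_derivable; [exact: df|exact: dg].
Qed.

Lemma Ck_prod V k (U : set V) (I : Type) (r : seq I) (F : I -> V -> R) :
  open U -> (forall i, Ck k U (F i)) -> Ck k U (fun x => \prod_(i <- r) F i x).
Proof.
move=> oU CF; elim: r => [|i r IHr].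
  by under eq_fun do rewrite big_nil; exact: Ck_cst.
by under eq_fun do rewrite big_cons; exact: CkM.
Qed.

Lemma CkN V k (U : set V) (f : V -> R) : open U ->
  Ck k U f -> Ck k U (fun x => - f x).
Proof.
move=> oU Cf; under eq_fun do rewrite -mulN1r.
by apply: CkM => //; exact: Ck_cst.
Qed.

(** Induction works because the derivative of the inverse is again built from
    the inverse, one order of differentiability lower. *)
Lemma CkV V k (U : set V) (f : V -> R) : open U ->
  (forall x, U x -> f x != 0) -> Ck k U f -> Ck k U (fun x => (f x)^-1).
Proof.
move=> oU f0; elim: k => [cf x Ux|k IHk Cf].
  by apply: cvgV; [exact: f0|exact: cf].
have CVf := IHk (CkS Cf); have [df Df] := Cf; split=> [x Ux|v].
  by apply: differentiableV; [exact: df|exact: f0].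
apply: Ck_eq (CkM oU (CkN oU (CkM oU CVf CVf)) (Df v)) => // x Ux.
rewrite [in RHS]deriveV ?f0//; last by apply: diff_derivable; exact: df.
by rewrite -invfM -expr2.
Qed.

Lemma differentiable_mx V m n (f : V -> 'M[R]_(m, n)) (x : V) :
  (forall i j, differentiable (fun y => f y i j) x) -> differentiable f x.
Proof.
move=> df.
have -> : f = \sum_p (fun y => f y p.1 p.2 *: delta_mx p.1 p.2).
  apply/funext => y; rewrite fct_sumE {1}(matrix_sum_delta (f y)) pair_big.
  by apply: eq_bigr.
elim/big_ind: _ => [|g h dg dh|p _]; first exact: differentiable_cst.
  exact: differentiableD.
by apply: differentiableZl.
Qed.

Lemma differentiable_entry V m n (f : V -> 'M[R]_(m, n)) (x : V) i j :
  differentiable f x -> differentiable (fun y => f y i j) x.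
Proof.
move=> df; apply: (differentiable_comp (g := fun N : 'M[R]_(m, n) => N i j)) => //.
exact: differentiable_coord.
Qed.

Lemma derive_entry V m n (f : V -> 'M[R]_(m, n)) (x v : V) i j :
  derivable f x v -> 'D_v (fun y => f y i j) x = 'D_v f x i j.
Proof. by move=> df; rewrite (derive_mx df) mxE. Qed.

Lemma CkP V m n k (U : set V) (f : V -> 'M[R]_(m, n)) : open U ->
  Ck k U f <-> forall i j, Ck k U (fun x => f x i j).
Proof.
move=> oU; elim: k f => [|k IHk] f.
  split=> cf => [i j x Ux|x Ux].
    apply: (@continuous_comp _ _ _ f (fun N : 'M[R]_(m, n) => N i j)); first exact: cf.
    exact/differentiable_continuous/differentiable_coord.
  have -> : f = \sum_p (fun y => f y p.1 p.2 *: delta_mx p.1 p.2).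
    apply/funext => y; rewrite fct_sumE {1}(matrix_sum_delta (f y)) pair_big.
    by apply: eq_bigr.
  elim/big_ind: _ => [|g h dg dh|p _]; first exact: cvg_cst.
    exact: cvgD.
  by apply: cvgZl; apply: cf.
split=> [[df Df] i j|Cf].
  split=> [x Ux|v]; first by apply: differentiable_entry; exact: df.
  have /IHk/(_ i j) := Df v; apply: Ck_eq => // x Ux.
  by rewrite derive_entry//; apply: diff_derivable; exact: df.
have df x : U x -> differentiable f x.
  by move=> Ux; apply: differentiable_mx => i j; have [+ _] := Cf i j; apply.
split=> // v; apply/IHk => i j; have [_ /(_ v)] := Cf i j.
by apply: Ck_eq => // x Ux; rewrite derive_entry//; apply: diff_derivable; exact: df.
Qed.

Lemma derive_lin V W (f : V -> W) (x : V) : differentiable f x ->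
  linear (fun v => 'D_v f x).
Proof. by move=> df a u v; rewrite !deriveE// linearP. Qed.

Lemma derive_chain (U : normedModType R) V W (f : U -> V) (g : V -> W) x v :
  differentiable f x -> differentiable g (f x) ->
  'D_v (g \o f) x = 'D_('D_v f x) g (f x).
Proof.
move=> df dg; rewrite deriveE; last exact: differentiable_comp.
by rewrite diff_comp//= -(deriveE v df) -(deriveE _ dg).
Qed.

Lemma derive_rowE n W (f : 'rV[R]_n -> W) x v : differentiable f x ->
  'D_v f x = \sum_i v ord0 i *: 'D_(delta_mx ord0 i) f x.
Proof.
move=> df; rewrite deriveE// {1}(row_sum_delta v) linear_sum.
by apply: eq_bigr => i _; rewrite linearZ deriveE.
Qed.

Lemma derive_real (f : R -> R) (x v : R) : differentiable f x ->
  'D_v f x = v * 'D_1 f x.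
Proof.
move=> df; rewrite !deriveE// -[X in 'd f _ X]mulr1 -[X in 'd f _ X]/(v *: 1).
exact: linearZ.
Qed.

(** By the chain rule, a derivative of the composite is a sum of products of entries
    of ['D_v g] with partial derivatives of [f] composed with [g]. *)
Lemma Ck_comp V n k (U : set V) (U' : set 'rV[R]_n) (g : V -> 'rV[R]_n)
    (f : 'rV[R]_n -> R) :
  open U -> (forall x, U x -> U' (g x)) ->
  Ck k U g -> Ck k U' f -> Ck k U (f \o g).
Proof.
move=> oU gU; elim: k f => [|k IHk] f Cg Cf.
  by move=> x Ux; apply: continuous_comp; [exact: Cg|exact: (Cf _ (gU _ Ux))].
have [[dg Dg] [df Df]] := (Cg, Cf); split=> [x Ux|v].
  by apply: differentiable_comp; [exact: dg|exact: (df _ (gU _ Ux))].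
apply: (Ck_eq (f := fun x => \sum_i 'D_v g x ord0 i *
   ('D_(delta_mx ord0 i) f \o g) x)) => // [x Ux|].
  rewrite [in RHS]derive_chain; [|exact: dg|exact: (df _ (gU _ Ux))].
  by rewrite [in RHS]derive_rowE//; exact: (df _ (gU _ Ux)).
apply: Ck_sum => // i; apply: CkM => //.
  by have /CkP := Dg v; apply.
by apply: IHk; [exact: CkS|exact: Df].
Qed.

Lemma Ck_comp1 V k (U : set V) (g : V -> R) (f : R -> R) :
  open U -> Ck k U g -> Ck k setT f -> Ck k U (f \o g).
Proof.
move=> oU; elim: k f => [|k IHk] f Cg Cf.
  by move=> x Ux; apply: continuous_comp; [exact: Cg|exact: Cf].
have [[dg Dg] [df Df]] := (Cg, Cf); split=> [x Ux|v].
  by apply: differentiable_comp; [exact: dg|exact: df].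
apply: (Ck_eq (f := fun x => 'D_v g x * ('D_1 f \o g) x)) => // [x Ux|].
  rewrite [in RHS]derive_chain; [|exact: dg|exact: df].
  by rewrite [in RHS]derive_real//; exact: df.
apply: CkM => //; first exact: Dg.
by apply: IHk; [exact: CkS|exact: Df].
Qed.

End Calculus.

(** * Smooth bump functions *)

Section FlatExponential.
Variable R : realType.

(** The powers of [t^-1] are there to make the family closed under
    differentiation. *)
Definition flat_exp (k : nat) (t : R) : R :=
  if 0 < t then t^-1 ^+ k * expR (- t^-1) else 0.

(** The exponential dominates each term of its power series, here the one of
    degree [k.+1] at [t^-1]. *)
Lemma flat_exp_le k t : `|flat_exp k t| <= k.+1`!%:R * `|t|.
Proof.
rewrite /flat_exp; case: ifPn => [t0|_]; last by rewrite normr0 mulr_ge0.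
have s0 : 0 <= t^-1 by rewrite invr_ge0 ltW.
rewrite ger0_norm ?mulr_ge0 ?exprn_ge0 ?expR_ge0// (gtr0_norm t0).
have -> : t^-1 ^+ k = t * t^-1 ^+ k.+1 by rewrite exprS mulrA divff ?gt_eqF// mul1r.
rewrite -mulrA [leRHS]mulrC ler_pM2l// expRN ler_pdivrMr ?expR_gt0//.
rewrite -ler_pdivrMl ?ltr0n ?fact_gt0// mulrC.
by apply: le_trans (expR_ge1Dxn k s0); rewrite lerDr.
Qed.

(** The difference quotient of [flat_exp k] at 0. *)
Lemma flat_exp_slope k (h : R) : h^-1 * flat_exp k h = flat_exp k.+1 h.
Proof. by rewrite /flat_exp; case: ifP => _; rewrite ?mulr0// mulrA exprS. Qed.

Lemma flat_exp_cvg0 k : flat_exp k @ 0^' --> (0 : R).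
Proof.
apply/cvgr0Pnorm_lt => e e0; near=> h; apply: le_lt_trans (flat_exp_le k h) _.
rewrite mulrC -ltr_pdivlMr ?ltr0n ?fact_gt0//.
by near: h; apply: dnbhs0_lt; rewrite divr_gt0// ltr0n fact_gt0.
Unshelve. all: by end_near. Qed.

Lemma is_derive_flat_exp k (t : R) :
  is_derive t 1 (flat_exp k) (flat_exp k.+2 t - k%:R * flat_exp k.+1 t).
Proof.
have [t0|t0|->] := ltgtP t 0.
- have -> : flat_exp k.+2 t - k%:R * flat_exp k.+1 t = 0.
    by rewrite /flat_exp !(lt_gtF t0) mulr0 subr0.
  apply: near_eq_is_derive (is_derive_cst (0 : R) t 1).
  near=> u; rewrite /flat_exp ifF//; apply/negbTE; rewrite -leNgt ltW//.
  by near: u; exact: lt_nbhsl.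
- have nfl : \forall u \near t, u^-1 ^+ k * expR (- u^-1) = flat_exp k u.
    near=> u; rewrite /flat_exp ifT//; near: u; exact: lt_nbhsr.
  apply: near_eq_is_derive nfl _.
  have tn0 : t != 0 by rewrite gt_eqF.
  have dV : is_derive t 1 (fun u : R => u^-1) (- t ^- 2).
    apply: DeriveDef; first exact: derivableV.
    by rewrite deriveV// derive_id [LHS]mulr1.
  have dX := is_deriveX k dV.
  have dE := is_derive1_comp (g := fun u : R => - u^-1) (is_derive_expR (- t^-1)) (is_deriveN dV).
  have -> : (fun u : R => u^-1 ^+ k * expR (- u^-1)) =
      (fun u => u^-1) ^+ k * (expR \o (fun u => - u^-1)).
    by apply/funext => u; rewrite exprfctE.
  apply: is_derive_eq (is_deriveM dX dE) _; rewrite exprfctE.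
  rewrite /flat_exp t0 !fctE /= opprK.
  case: k {dX} => [|k]; rewrite /GRing.scale/= ?mul0r.
    by rewrite !(expr0, expr1, mul0r, mulr0, addr0, subr0, mul1r) mulrC exprVn.
  rewrite -!exprVn !exprS; ring.
- have cf : (fun h : R => h^-1 *: ((flat_exp k \o shift 0) (h *: 1) - flat_exp k 0)) @ 0^' --> (0 : R).
    suff -> : (fun h : R => h^-1 *: ((flat_exp k \o shift 0) (h *: 1) - flat_exp k 0)) = flat_exp k.+1.
      exact: flat_exp_cvg0.
    apply/funext => h; rewrite -flat_exp_slope /= {2}/flat_exp ltxx subr0 addr0.
    by rewrite [h *: 1]mulr1.
  apply: DeriveDef; first by apply/cvg_ex; exists 0; exact: cf.
  rewrite /flat_exp ltxx mulr0 subr0 -/(flat_exp k); exact: cvg_lim cf.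
Unshelve. all: by end_near. Qed.

Lemma smooth_flat_exp k j : Ck k setT (flat_exp j).
Proof.
have diff_flat_exp i (t : R) : differentiable (flat_exp i) t.
  by apply/derivable1_diffP; case: (is_derive_flat_exp i t).
elim: k j => [|k IHk] j; first by move=> t _; exact: differentiable_continuous.
split=> [t _|v]; first exact: diff_flat_exp.
apply: (Ck_eq (f := fun t => v * (flat_exp j.+2 t - j%:R * flat_exp j.+1 t))) => [|t _|].
- exact: openT.
- by rewrite [in RHS]derive_real//; have [_ ->] := is_derive_flat_exp j t.
apply: CkM; [exact: openT|exact: Ck_cst|].
apply: CkD; [exact: openT|exact: IHk|].
apply: CkN; [exact: openT|].
by apply: CkM; [exact: openT|exact: Ck_cst|exact: IHk].
Qed.

End FlatExponential.

Section Bump.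
Variables (R : realType) (n : nat).

(** The function is [exp(-1/q)] up to a constant, with [q] equal to [r^2] minus the
    squared Euclidean distance to [y0]; its support lies in the cube of half-side
    [r]. *)
Lemma bump_rV (U : set 'rV[R]_n) (y0 : 'rV[R]_n) : open U -> U y0 ->
  exists (eta : 'rV[R]_n -> R) (K : set 'rV[R]_n),
    [/\ smooth_on setT eta, eta y0 = 1, compact K, K `<=` U
      & forall y, ~ K y -> eta y = 0].
Proof.
move=> oU Uy0; have [e /= e0 eU] : nbhs_ball y0 U.
  by apply/nbhs_ballP; exact: open_nbhs_nbhs.
pose r := e / 2; have r0 : 0 < r by rewrite divr_gt0.
pose q (y : 'rV[R]_n) := r ^+ 2 - \sum_i (y ord0 i - y0 ord0 i) ^+ 2.
have F0 : flat_exp 0 (r ^+ 2) != 0.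
  by rewrite /flat_exp exprn_gt0// mul1r gt_eqF// expR_gt0.
exists (fun y => flat_exp 0 (q y) / flat_exp 0 (r ^+ 2)).
exists [set y : 'rV[R]_n | forall i, `[y0 ord0 i - r, y0 ord0 i + r]%classic (y ord0 i)].
split.
- move=> k; apply: CkM; [exact: openT| |exact: Ck_cst].
  apply: (Ck_comp1 (g := q) (f := flat_exp 0)); [exact: openT| |exact: smooth_flat_exp].
  apply: CkD; [exact: openT|exact: Ck_cst|apply: CkN; first exact: openT].
  apply: Ck_sum => [|i]; first exact: openT.
  suff Cc : Ck k setT (fun y : 'rV[R]_n => y ord0 i - y0 ord0 i).
    by under eq_fun do rewrite expr2; apply: CkM => //; exact: openT.
  apply: CkD; [exact: openT| |exact: Ck_cst].
  case: k => [y _|k]; first exact/differentiable_continuous/differentiable_coord.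
  split=> [y _|v]; first exact: differentiable_coord.
  have -> : (fun y : 'rV[R]_n => 'D_v (fun y : 'rV[R]_n => y ord0 i) y) = fun=> v ord0 i.
    apply/funext => y; rewrite derive_entry; first by rewrite derive_id.
    exact: derivable_id.
  exact: Ck_cst.
- have -> : q y0 = r ^+ 2; last by rewrite divff.
  by rewrite /q big1 ?subr0// => i _; rewrite subrr expr0n.
- apply: (@rV_compact _ _ (fun i => `[y0 ord0 i - r, y0 ord0 i + r]%classic)).
  by move=> i; exact: segment_compact.
- move=> y Ky; apply: eU; rewrite mx_norm_ball /ball_ /= [ltLHS]mx_normrE.
  apply: (@le_lt_trans _ _ r); last by rewrite /r; lra.
  apply: bigmax_le => [|[i j] _ /=]; first exact: ltW.
  rewrite !mxE ord1 ler_distlC; have := Ky j; rewrite /= in_itv /=.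
  by move=> /andP[-> ->].
- move=> y nK; rewrite /flat_exp ifF ?mul0r//; apply/negP => qy; apply: nK => i /=.
  have qi : (y ord0 i - y0 ord0 i) ^+ 2 <= r ^+ 2.
    move: qy; rewrite /q subr_gt0 => /ltW; apply: le_trans.
    by rewrite (bigD1 i)//= lerDl sumr_ge0// => j _; exact: sqr_ge0.
  rewrite in_itv /= -ler_distlC distrC -(ler_pXn2r (n := 2))// ?nnegrE// ?(ltW r0)//.
  by rewrite real_normK ?num_real.
Qed.

End Bump.

(** * Charts and tangent vectors *)

Section Charts.
Variables (R : realType) (n : nat) (M : manifold R n).
Implicit Types (a b c d : chart M) (x : M).

Definition img c : set 'rV[R]_n := coord c @` dom c.

Lemma coord_img c x : dom c x -> img c (coord c x).
Proof. by exists x. Qed.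

Lemma param_dom c y : img c y -> dom c (param c y).
Proof. by move=> [x cx <-]; rewrite coordK. Qed.

Lemma paramK c y : img c y -> coord c (param c y) = y.
Proof. by move=> [x cx <-]; rewrite coordK. Qed.

Lemma coord_open c (A : set M) : open A -> open (coord c @` (dom c `&` A)).
Proof.
move=> oA; have -> : coord c @` (dom c `&` A) = img c `&` param c @^-1` A.
  rewrite eqEsubset; split => [_ [x [cx Ax] <-]|y [iy Ay]].
    by split; [exact: coord_img|rewrite /preimage /= coordK].
  by exists (param c y); [split=> //; exact: param_dom|exact: paramK].
have := @param_continuous _ _ M c; rewrite continuous_open_subspace; last exact: img_open.
move=> cp; rewrite openE => y [iy Ay]; apply: filterI.
  by apply: open_nbhs_nbhs; split=> //; exact: img_open.
by apply: cp; [rewrite inE|exact: open_nbhs_nbhs].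
Qed.

Lemma overlap_open c d : open (coord c @` (dom c `&` dom d)).
Proof. by apply: coord_open; exact: dom_open. Qed.

Lemma overlapP c d y : (coord c @` (dom c `&` dom d)) y <->
  img c y /\ dom d (param c y).
Proof.
split=> [[x [cx dx] <-]|[iy dy]]; first by rewrite coordK//; split=> //; exists x.
by exists (param c y); [split=> //; exact: param_dom|exact: paramK].
Qed.

Lemma near_img c x : dom c x -> \forall y \near coord c x, img c y.
Proof.
by move=> cx; apply: open_nbhs_nbhs; split; [exact: img_open|exact: coord_img].
Qed.

Lemma near_overlap c d x : dom c x -> dom d x ->
  \forall y \near coord c x, img c y /\ dom d (param c y).
Proof.
move=> cx dx; have : nbhs (coord c x) (coord c @` (dom c `&` dom d)).
  by apply: open_nbhs_nbhs; split; [exact: overlap_open|exists x].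
by apply: filterS => y /overlapP.
Qed.

Lemma diff_trans c d x : dom c x -> dom d x ->
  differentiable (coord d \o param c) (coord c x).
Proof.
by move=> cx dx; have [+ _] := transition_smooth c d 1; apply; exists x.
Qed.

Lemma trans_id c x w : dom c x -> 'D_w (coord c \o param c) (coord c x) = w.
Proof.
move=> cx; rewrite -[RHS](derive_id (coord c x) w); apply: near_eq_derive.
by have := near_img cx; apply: filterS => y iy /=; rewrite paramK.
Qed.

(** The chain rule for transition maps; it makes [tcomp c] and [tvec c] mutually
    inverse and independent of the charts chosen by [chart_at]. *)
Lemma trans_comp a b c x w : dom a x -> dom b x -> dom c x ->
  'D_('D_w (coord b \o param a) (coord a x)) (coord c \o param b) (coord b x) =
  'D_w (coord c \o param a) (coord a x).
Proof.
move=> ax bx cx.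
have -> : coord b x = (coord b \o param a) (coord a x) by rewrite /= coordK.
rewrite -derive_chain; [|exact: diff_trans|]; last first.
  by rewrite /= coordK//; exact: diff_trans.
apply: near_eq_derive; have := near_overlap ax bx; apply: filterS => y [iy by_].
by rewrite /= coordK.
Qed.

Lemma tcomp_at x v : tcomp (chart_at x) x v = v.
Proof. by apply: trans_id; exact: dom_chart_at. Qed.

Lemma tvec_at x v : tvec (chart_at x) x v = v.
Proof. by apply: trans_id; exact: dom_chart_at. Qed.

Lemma tcomp_tvec c d x w : dom c x -> dom d x ->
  tcomp d x (tvec c x w) = 'D_w (coord d \o param c) (coord c x).
Proof. by move=> cx dx; apply: trans_comp => //; exact: dom_chart_at. Qed.

Lemma tcompK c x v : dom c x -> tvec c x (tcomp c x v) = v.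
Proof.
move=> cx; rewrite /tvec /tcomp trans_comp ?trans_id//; exact: dom_chart_at.
Qed.

Lemma tvecK c x v : dom c x -> tcomp c x (tvec c x v) = v.
Proof. by move=> cx; rewrite tcomp_tvec// trans_id. Qed.

Lemma tcomp_linear c x : dom c x -> linear (tcomp c x).
Proof.
by move=> cx; apply: derive_lin; apply: diff_trans => //; exact: dom_chart_at.
Qed.

Lemma tvec_linear c x : dom c x -> linear (tvec c x).
Proof.
by move=> cx; apply: derive_lin; apply: diff_trans => //; exact: dom_chart_at.
Qed.

Lemma tcompZ c x (r : R) v : dom c x -> tcomp c x (r *: v) = r *: tcomp c x v.
Proof.
move=> cx; have := tcomp_linear cx r v 0.
by rewrite addr0 [tcomp _ _ 0]derive0 addr0.
Qed.

Lemma tcomp_sum c x (I : Type) (r : seq I) (F : I -> 'rV[R]_n) : dom c x ->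
  tcomp c x (\sum_(i <- r) F i) = \sum_(i <- r) tcomp c x (F i).
Proof.
move=> cx; apply: (big_morph (tcomp c x)); last exact: derive0.
by move=> u v; rewrite -[u]scale1r tcomp_linear// !scale1r.
Qed.

Lemma tvecE c x (v : 'rV[R]_n) : dom c x ->
  tvec c x v = \sum_i v ord0 i *: tvec c x (delta_mx ord0 i).
Proof.
move=> cx; have tv := tvec_linear cx; have tv0 : tvec c x 0 = 0 by exact: derive0.
rewrite {1}(row_sum_delta v) (big_morph (tvec c x) (id1 := 0) (op1 := +%R))//.
  apply: eq_bigr => i _; have := tv (v ord0 i) (delta_mx ord0 i) 0.
  by rewrite addr0 tv0 addr0.
by move=> u w; rewrite -[u]scale1r tv !scale1r.
Qed.

End Charts.

(** * Extending local objects by zero *)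

Section Cutoff.
Variables (R : realType) (n : nat) (M : manifold R n).
Implicit Types (c d : chart M) (x z : M) (f g : M -> R).

Lemma smooth_pull c d k (f : 'rV[R]_n -> R) : Ck k (img c) f ->
  Ck k (coord d @` (dom d `&` dom c)) (f \o (coord c \o param d)).
Proof.
apply: Ck_comp; [exact: overlap_open| |exact: transition_smooth].
by move=> y /overlapP[iy cy]; exact: coord_img.
Qed.

(** The overlap with the chart [c] and the complement of [K] form an open cover, and
    [F] is smooth on each piece. *)
Lemma smooth_glue (W : normedModType R) c d (K : set M) (F : 'rV[R]_n -> W) :
  closed K -> smooth_on (coord d @` (dom d `&` dom c)) F ->
  (forall y, img d y -> ~ K (param d y) -> F y = 0) -> K `<=` dom c ->
  smooth_on (img d) F.
Proof.
move=> cK sF F0 Kc k; apply: Ck_local => y iy.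
have [cy|ncy] := pselect (dom c (param d y)).
  by exists (coord d @` (dom d `&` dom c)); [exact/overlapP|exact: sF].
exists (coord d @` (dom d `&` ~` K)).
  exists (param d y); [split; [exact: param_dom|by move=> /Kc]|exact: paramK].
apply: (Ck_eq (f := fun=> 0)); [|move=> _ [z [dz Kz] <-]|exact: Ck_cst].
  by apply: coord_open; exact: closed_openC.
by rewrite F0//; [exact: coord_img|rewrite coordK].
Qed.

Lemma smooth_fun_cst (r : R) : smooth_fun (fun _ : M => r).
Proof. by move=> c k; exact: Ck_cst. Qed.

Lemma smooth_funM f g : smooth_fun f -> smooth_fun g ->
  smooth_fun (fun z => f z * g z).
Proof. by move=> sf sg c k; apply: CkM; [exact: img_open|exact: sf|exact: sg]. Qed.

Lemma smooth_funB f g : smooth_fun f -> smooth_fun g ->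
  smooth_fun (fun z => f z - g z).
Proof.
move=> sf sg c k; apply: CkD; [exact: img_open|exact: sf|].
by apply: CkN; [exact: img_open|exact: sg].
Qed.

(** [K] is the image of a compact set of coordinates; it is closed in [M] because [M]
    is Hausdorff, which is what makes the extension by zero smooth. *)
Lemma cutoff c x : dom c x -> exists (chi : M -> R) (K : set M),
  [/\ smooth_fun chi, chi x = 1, closed K, K `<=` dom c
    & forall z, ~ K z -> chi z = 0].
Proof.
move=> cx; have [eta [K [seta eta1 cK Ki eta0]]] :=
  bump_rV (@img_open _ _ M c) (coord_img cx).
pose chi z := if pselect (dom c z) then eta (coord c z) else 0.
have chi_in z : dom c z -> chi z = eta (coord c z) by rewrite /chi; case: pselect.
have Kc : param c @` K `<=` dom c by move=> _ [y /Ki iy <-]; exact: param_dom.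
have chi0 z : ~ (param c @` K) z -> chi z = 0.
  rewrite /chi; case: pselect => //= cz nK; apply: eta0 => Kz; apply: nK.
  by exists (coord c z); rewrite ?coordK.
have clK : closed (param c @` K).
  apply: compact_closed; first exact: carrier_hausdorff.
  apply: continuous_compact cK.
  exact: continuous_subspaceW Ki (@param_continuous _ _ M c).
exists chi, (param c @` K); split=> //; first last.
  by rewrite chi_in.
move=> d; apply: smooth_glue clK _ _ Kc => [k|y _]; last exact: chi0.
apply: (Ck_eq (f := eta \o (coord c \o param d))).
- exact: overlap_open.
- by move=> y /overlapP[_ cy] /=; rewrite chi_in.
- by apply: smooth_pull; apply: Ck_sub (seta k).
Qed.

(** The components of a coordinate field in another chart [d] are derivatives of the
    transition map. *)
Lemma smooth_cut_field c (K : set M) (chi : M -> R) (a : 'rV[R]_n -> R) i :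
  smooth_fun chi -> closed K -> K `<=` dom c -> (forall z, ~ K z -> chi z = 0) ->
  smooth_on (img c) a ->
  smooth_vfield (fun z : M =>
    (chi z * a (coord c z)) *: tvec c z (delta_mx ord0 i)).
Proof.
move=> schi clK Kc chi0 sa d; rewrite setIT.
apply: smooth_glue clK _ _ Kc => [k|y iy nK]; last first.
  by rewrite chi0// mul0r scale0r /tcomp derive0.
have oU : open (coord d @` (dom d `&` dom c)) by exact: overlap_open.
apply/CkP => // r j.
pose T y := 'D_(delta_mx ord0 i) (coord d \o param c) y r j.
apply: (Ck_eq (f := fun y => (chi (param d y) * (a \o (coord c \o param d)) y) *
  (T \o (coord c \o param d)) y)) => // [y /overlapP[iy cy]|].
  have dy := param_dom iy.
  by rewrite /= tcompZ// mxE tcomp_tvec//.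
apply: CkM => //; first apply: CkM => //.
- by apply: Ck_sub (schi d k) => y /overlapP[].
- exact: smooth_pull.
apply: (Ck_comp (U' := coord c @` (dom c `&` dom d))) => //.
- move=> y /overlapP[iy cy]; exists (param d y); last by [].
  by split=> //; exact: param_dom.
- exact: transition_smooth.
have [_ /(_ (delta_mx ord0 i))] := transition_smooth c d k.+1.
by move=> /CkP; apply; exact: overlap_open.
Qed.

Lemma smooth_vfield_sum (I : Type) (r : seq I) (X : I -> vfield M) :
  (forall i, smooth_vfield (X i)) -> smooth_vfield (fun z => \sum_(i <- r) X i z).
Proof.
move=> sX d k; rewrite setIT.
apply: (Ck_eq (f := fun y => \sum_(i <- r) tcomp d (param d y) (X i (param d y)))).
- exact: img_open.
- by move=> y iy; rewrite tcomp_sum//; exact: param_dom.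
- by apply: Ck_sum => [|i]; [exact: img_open|have := sX i d k; rewrite setIT].
Qed.

End Cutoff.

(** * Bilinear forms and duality *)

Section Duality.
Variable R : realType.
Implicit Types V W : vectType R.

Lemma linfun_linE V W (f : V -> W) : linear f -> linfun f =1 f.
Proof.
move=> lf; pose L := GRing.isLinear.Build _ _ _ _ f lf.
pose g : {linear V -> W} := HB.pack f L.
by move=> x; exact: (lfunE g).
Qed.

Lemma dim_dualsp V : dim (dualsp V) = dim V.
Proof. exact: muln1. Qed.

Lemma hatE V (B : V -> V -> R) u v : is_bilinear B -> hat B u v = B u v.
Proof.
move=> [Bl Br]; have E w : linfun (fun v => B w v : R^o) =1 B w by exact: linfun_linE.
rewrite /hat linfun_linE ?E// => a x y.
by apply/lfunP => z; rewrite add_lfunE scale_lfunE !E; exact: Bl.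
Qed.

Lemma hat_trE V (B : V -> V -> R) u v : is_bilinear B -> hat_tr B u v = B v u.
Proof.
move=> [Bl Br]; have E w : linfun (fun v => B v w : R^o) =1 B^~ w by exact: linfun_linE.
rewrite /hat_tr linfun_linE ?E// => a x y.
by apply/lfunP => z; rewrite add_lfunE scale_lfunE !E; exact: Br.
Qed.

Lemma bidualE V (v : V) (b : dualsp V) : bidual V v b = b v.
Proof.
have E w : linfun (fun b : dualsp V => b w) =1 (fun b : dualsp V => b w).
  by apply: linfun_linE => a x y; rewrite add_lfunE scale_lfunE.
rewrite /bidual linfun_linE ?E// => a x y.
by apply/lfunP => z; rewrite add_lfunE scale_lfunE !E linearP.
Qed.

Lemma dual_sep V (v : V) : (forall b : dualsp V, b v = 0) -> v = 0.
Proof.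
move=> b0; rewrite (coord_vbasis (memvf v)) big1// => i _.
have lin : linear (fun w : V => vector.coord (vbasis fullv) i w : R^o).
  by move=> a x y; rewrite linearP.
have := b0 (linfun (fun w : V => vector.coord (vbasis fullv) i w : R^o)).
by rewrite linfun_linE// => ->; rewrite scale0r.
Qed.

Lemma dualP V (b : dualsp V) (k : R) u v : b (k *: u + v) = k * b u + b v.
Proof. exact: linearP. Qed.

Lemma dualDZ V (b b' : dualsp V) (k : R) u : (k *: b + b') u = k * b u + b' u.
Proof. by rewrite add_lfunE scale_lfunE. Qed.

Lemma inj_lker0 V W (f : 'Hom(V, W)) : (forall v, f v = 0 -> v = 0) -> lker f == 0%VS.
Proof.
move=> f0; rewrite -subv0; apply/subvP => v; rewrite memv_ker memv0 => /eqP/f0 ->.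
exact: eqxx.
Qed.

Lemma inj_surj V W (f : 'Hom(V, W)) : dim V = dim W -> lker f == 0%VS ->
  forall w, f (f^-1%VF w) = w.
Proof.
move=> dVW kf w; apply: limg_lfunVK.
suff -> : limg f = fullv by exact: memvf.
apply/eqP; rewrite eqEdim subvf /= limg_dim_eq ?(eqP kf) ?capv0// !dimvf dVW.
by [].
Qed.

Lemma bidual_inj V : lker (bidual V) == 0%VS.
Proof.
apply: inj_lker0 => v bv; apply: dual_sep => b; rewrite -bidualE bv.
by rewrite lfunE.
Qed.

Lemma bidualVK V (v : V) : ((bidual V)^-1)%VF (bidual V v) = v.
Proof. exact/lker0_lfunK/bidual_inj. Qed.

Lemma form_eval_form V (a : seq V -> R) vs : form_eval (form_of a) vs = a vs.
Proof. by rewrite /form_eval /form_of -map_comp map_id_in// => v _ /=; rewrite bidualVK. Qed.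

Section Nondegenerate.
Variables (V : vectType R) (B : V -> V -> R).
Hypotheses (bB : is_bilinear B) (ndB : bijective (hat B)).

Definition hat_inv (b : dualsp V) : V := ((hat B)^-1)%VF b.

Lemma hat_inj : lker (hat B) == 0%VS.
Proof.
by apply/inj_lker0 => v hv; apply: (bij_inj ndB); rewrite hv linear0.
Qed.

Lemma hat_invE b v : B (hat_inv b) v = b v.
Proof. by rewrite -hatE// inj_surj ?dim_dualsp// hat_inj. Qed.

(** If [B(_, v) = 0] then every covector, being of the form [B(w, _)], kills [v]. *)
Lemma hat_tr_inj : lker (hat_tr B) == 0%VS.
Proof.
apply: inj_lker0 => v hv; apply: dual_sep => b.
by rewrite -hat_invE -hat_trE// hv lfunE.
Qed.

(** Transposing [hat_tr B] gives [hat B], after the identification of a space with its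
    bidual. *)
Lemma bidual_hat_inv b :
  ((bidual V)^-1)%VF (b \o (hat_tr B)^-1)%VF = hat_inv b.
Proof.
rewrite -[RHS]bidualVK; congr (_ _); apply/lfunP => al.
rewrite bidualE comp_lfunE -[LHS]hat_invE -hat_trE// inj_surj ?dim_dualsp//.
exact: hat_tr_inj.
Qed.

Lemma hat_inv_linear : linear hat_inv.
Proof. by move=> a x y; rewrite /hat_inv linearP. Qed.

Lemma sharp_form2 (w : V -> V -> R) l :
  ext_map ((hat_tr B)^-1)%VF (form2 w) l =
  if l is [:: b1; b2] then w (hat_inv b1) (hat_inv b2) else 0.
Proof.
rewrite /ext_map /form2 /form_of; case: l => [|b1 [|b2 [|b3 l]]] //=.
by rewrite !bidual_hat_inv.
Qed.

Lemma skew_hat_inv b1 b2 :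
  skew_part B (hat_inv b1) (hat_inv b2) = 2^-1 * (b1 (hat_inv b2) - b2 (hat_inv b1)).
Proof. by rewrite /skew_part !hat_invE. Qed.

Lemma exterior_sharp :
  exterior 2 (ext_map ((hat_tr B)^-1)%VF (form2 (skew_part B))).
Proof.
split=> [l|l1 l2 k b b'|l].
- by rewrite sharp_form2; case: l => [|b1 [|b2 [|b3 l]]].
- rewrite !sharp_form2.
  case: l1 => [|c [|c' l1]]; case: l2 => [|d [|d' l2]] //=; rewrite ?mulr0 ?addr0 //.
  + by rewrite !skew_hat_inv hat_inv_linear dualP !dualDZ; ring.
  + by rewrite !skew_hat_inv hat_inv_linear dualP !dualDZ; ring.
  + by case: l1 => [|? ?]; rewrite ?mulr0 ?addr0.
  + by case: l1 => [|? ?]; rewrite ?mulr0 ?addr0.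
  + by case: l1 => [|? ?]; rewrite ?mulr0 ?addr0.
- rewrite sharp_form2; case: l => [|b1 [|b2 [|b3 l]]] //=.
  rewrite andbT inE negbK => /eqP ->; by rewrite skew_hat_inv subrr mulr0.
Qed.

End Nondegenerate.
End Duality.

(** * Exterior products in low degree *)

Section Wedge.
Variable R : realType.
Implicit Types V : vectType R.

(** A form of the sum over all shuffles that evaluates by computation on lists of
    given length. *)
Fixpoint sum_bits (k : nat) (F : seq bool -> R) : R :=
  if k is j.+1 then
    sum_bits j (fun m => F (true :: m)) + sum_bits j (fun m => F (false :: m))
  else F [::].

Lemma sum_bitsE k (F : seq bool -> R) :
  \sum_(m : k.-tuple bool) F m = sum_bits k F.
Proof.
elim: k F => [|k IHk] F /=.
  rewrite (bigD1 [tuple]) //= big1 ?addr0// => m /eqP[]; exact: tuple0.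
rewrite -!IHk -big_split.
rewrite (reindex (fun p : k.-tuple bool * bool => [tuple of p.2 :: p.1])) /=.
  rewrite -(pair_bigA _ (fun (m : k.-tuple bool) (b : bool) => F (b :: m))) /=.
  by apply: eq_bigr => m _; rewrite big_bool.
exists (fun m : k.+1.-tuple bool => (behead_tuple m, thead m)) => [[m b] _ | m _] /=.
  by congr (_, _); apply: val_inj.
by rewrite -tuple_eta.
Qed.

Lemma wedgeE V (a b : ext V) l : wedge a b l = sum_bits (size l)
  (fun m => (-1) ^+ shuffle_inv m * a (mask m l) * b (mask (map negb m) l)).
Proof. by rewrite /wedge -sum_bitsE. Qed.

Definition ext1 V (u : V) : ext V := fun l => if l is [:: c] then c u else 0.

Lemma wedge1_1 V (u v : V) b1 b2 :
  wedge (ext1 u) (ext1 v) [:: b1; b2] = b1 u * b2 v - b2 u * b1 v.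
Proof. by rewrite wedgeE /=; ring. Qed.

Lemma wedge1_2 V (u : V) (a : ext V) b1 b2 b3 :
  wedge (ext1 u) a [:: b1; b2; b3] =
  b1 u * a [:: b2; b3] - b2 u * a [:: b1; b3] + b3 u * a [:: b1; b2].
Proof. by rewrite wedgeE /=; ring. Qed.

Lemma wedge2_1 V (u : V) (a : ext V) b1 b2 b3 :
  wedge a (ext1 u) [:: b1; b2; b3] =
  a [:: b1; b2] * b3 u - a [:: b1; b3] * b2 u + a [:: b2; b3] * b1 u.
Proof. by rewrite wedgeE /=; ring. Qed.

Lemma exterior1 V (u : V) : exterior 1 (ext1 u).
Proof.
split=> [l|l1 l2 k b b'|l].
- by case: l => [|b [|b' l]].
- case: l1 => [|c l1]; case: l2 => [|d l2] //=; rewrite ?mulr0 ?addr0 ?dualDZ//;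
    by case: l1 => [|? ?]; rewrite /= ?mulr0 ?addr0.
- by case: l => [|b [|b' l]].
Qed.

Lemma wedge1_1E V (u v : V) l :
  wedge (ext1 u) (ext1 v) l =
  if l is [:: b1; b2] then b1 u * b2 v - b2 u * b1 v else 0.
Proof.
case: l => [|b1 [|b2 [|b3 l]]]; rewrite ?wedge1_1//; try by rewrite wedgeE /= ?mulr0 ?mul0r ?addr0.
rewrite /wedge big1// => m _; case/tupleP: m => x m; case/tupleP: m => y m; case/tupleP: m => z m.
rewrite /ext1; case: x y z => [] [] [] /=; move: (mask m l) (mask (map negb m) l);
  by case=> [|? ?] [|? ?]; rewrite ?mulr0 ?mul0r.
Qed.

Lemma exterior1_1 V (u v : V) : exterior 2 (wedge (ext1 u) (ext1 v)).
Proof.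
split=> [l|l1 l2 k b b'|l].
- by rewrite wedge1_1E; case: l => [|b [|b' [|b'' l]]].
- rewrite !wedge1_1E.
  case: l1 => [|c [|c' l1]]; case: l2 => [|d [|d' l2]] //=; rewrite ?mulr0 ?addr0 //.
  + by rewrite !dualDZ; ring.
  + by rewrite !dualDZ; ring.
  + by case: l1 => [|? ?]; rewrite ?mulr0 ?addr0.
  + by case: l1 => [|? ?]; rewrite ?mulr0 ?addr0.
  + by case: l1 => [|? ?]; rewrite ?mulr0 ?addr0.
- rewrite wedge1_1E; case: l => [|b1 [|b2 [|b3 l]]] //=.
  rewrite andbT inE negbK => /eqP ->; by rewrite subrr.
Qed.

Lemma shuffle_inv_nseq k : shuffle_inv (nseq k false) = 0%N.
Proof. by elim: k => //= k ->; rewrite addn0 count_nseq. Qed.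

Lemma wedge0 V (r : R) (a : ext V) l :
  wedge (fun l => if l is [::] then r else 0) a l = r * a l.
Proof.
rewrite /wedge (bigD1 [tuple of nseq (size l) false]) //= big1 ?addr0 => [|m mn].
  by rewrite shuffle_inv_nseq expr0 mul1r mask_false map_nseq mask_true.
have : size (mask m l) != 0%N.
  rewrite size_mask ?size_tuple//; apply: contra mn => /eqP c0.
  have /all_pred1P mE : all (pred1 false) m.
    have : all (predC id) m by rewrite all_predC has_count c0.
    by apply: sub_all => -[].
  by apply/eqP/val_inj; rewrite [LHS]mE size_tuple.
by case: (mask m l) => // b l' _; rewrite mulr0 mul0r.
Qed.

End Wedge.

(** * Brackets of decomposable bivector fields *)

Section Multivectors.
Variables (R : realType) (n : nat) (M : manifold R n).
Implicit Types (X Y U V : vfield M) (P Q : mvfield M) (f g h : M -> R).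

Lemma dcoordE (c : chart M) x i (v : 'rV[R]_n) : dom c x ->
  dcoord c x i v = tcomp c x v ord0 i.
Proof.
move=> cx; rewrite /dcoord linfun_linE// => a u w.
by rewrite (tcomp_linear cx) !mxE.
Qed.

Lemma smooth_vfield_entry X (c : chart M) i : smooth_vfield X ->
  smooth_on (img c) (fun y => dcoord c (param c y) i (X (param c y))).
Proof.
move=> sX k; have := sX c k; rewrite setIT => /CkP/(_ ord0 i) Xk.
apply: Ck_eq (Xk _) => [|y iy|]; try exact: img_open.
by rewrite dcoordE//; exact: param_dom.
Qed.

Lemma multivector_vfield X : smooth_vfield X -> multivector 1 (mv_vfield X).
Proof.
move=> sX; split=> [x|c s k]; first exact: exterior1.
case: s => [|i [|j s]] /=; try exact: Ck_cst.
exact: smooth_vfield_entry.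
Qed.

Lemma multivector_wedge X Y : smooth_vfield X -> smooth_vfield Y ->
  multivector 2 (mv_wedge (mv_vfield X) (mv_vfield Y)).
Proof.
move=> sX sY; split=> [x|c s k]; first exact: exterior1_1.
have oi := @img_open _ _ M c.
apply: (Ck_eq (f := fun y => let x := param c y in
    if [seq dcoord c x i | i <- s] is [:: b1; b2] then
      b1 (X x) * b2 (Y x) - b2 (X x) * b1 (Y x) else 0)) => //.
  by move=> y _; rewrite /mv_wedge -wedge1_1E.
case: s => [|i [|j [|l s]]] /=; try exact: Ck_cst.
apply: CkD => //; last apply: CkN => //.
  by apply: CkM => //; exact: smooth_vfield_entry.
by apply: CkM => //; exact: smooth_vfield_entry.
Qed.

Lemma exterior0 (V : vectType R) (r : R) :
  exterior 0 ((fun l => if l is [::] then r else 0) : ext V).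
Proof.
split=> [l|l1 l2 k b b'|l].
- by case: l.
- by case: l1 => [|? ?] /=; rewrite mulr0 addr0.
- by case: l.
Qed.

Lemma multivector_fun f : smooth_fun f -> multivector 0 (mv_fun f).
Proof.
move=> sf; split=> [x|c s k]; first exact: exterior0.
by case: s => [|i s] /=; [exact: sf|exact: Ck_cst].
Qed.

Definition mv_mul f Q : mvfield M := fun x l => f x * Q x l.

Lemma mv_wedge_fun f Q : mv_wedge (mv_fun f) Q = mv_mul f Q.
Proof. by apply/funext => x; apply/funext => l; exact: wedge0. Qed.

Lemma multivector_mul p f Q : smooth_fun f -> multivector p Q ->
  multivector p (mv_mul f Q).
Proof.
move=> sf [eQ sQ]; split=> [x|c s k].
  have [e1 e2 e3] := eQ x; split=> [l sl|l1 l2 k b b'|l ul]; rewrite /mv_mul.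
  - by rewrite e1// mulr0.
  - by rewrite e2; ring.
  - by rewrite e3// mulr0.
apply: CkM; [exact: img_open|exact: sf|exact: sQ].
Qed.

Lemma mv_wedge1_1 X Y x b1 b2 :
  mv_wedge (mv_vfield X) (mv_vfield Y) x [:: b1; b2] =
  b1 (X x) * b2 (Y x) - b2 (X x) * b1 (Y x).
Proof. exact: wedge1_1. Qed.

Lemma mv_wedge1_2 X Q x b1 b2 b3 :
  mv_wedge (mv_vfield X) Q x [:: b1; b2; b3] =
  b1 (X x) * Q x [:: b2; b3] - b2 (X x) * Q x [:: b1; b3] + b3 (X x) * Q x [:: b1; b2].
Proof. exact: wedge1_2. Qed.

Lemma mv_wedge2_1 X Q x b1 b2 b3 :
  mv_wedge Q (mv_vfield X) x [:: b1; b2; b3] =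
  Q x [:: b1; b2] * b3 (X x) - Q x [:: b1; b3] * b2 (X x) + Q x [:: b2; b3] * b1 (X x).
Proof. exact: wedge2_1. Qed.

Section Bracket.
Variables (br : mvfield M -> mvfield M -> mvfield M).
Hypothesis Hbr : schouten_bracket br.

Local Notation "X /^\ Y" := (mv_wedge (mv_vfield X) (mv_vfield Y))
  (at level 40).

Lemma br_wedge1 X Y U x b1 b2 :
  smooth_vfield X -> smooth_vfield Y -> smooth_vfield U ->
  br (X /^\ Y) (mv_vfield U) x [:: b1; b2] =
  - (b1 (lie U X x) * b2 (Y x) - b2 (lie U X x) * b1 (Y x)
     + (b1 (X x) * b2 (lie U Y x) - b2 (X x) * b1 (lie U Y x))).
Proof.
move=> sX sY sU.
rewrite (sn_antisym Hbr (p := 2) (q := 1)); last 2 first.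
- exact: multivector_wedge.
- exact: multivector_vfield.
rewrite (sn_leibniz Hbr (p := 1) (q := 1) (r := 1)); try exact: multivector_vfield.
rewrite !(sn_lie Hbr)// /mv_sign /mv_lin !mv_wedge1_1.
by move: (lie U X x) (lie U Y x) => u v /=; ring.
Qed.

Lemma br_wedge2 X Y U V x b1 b2 b3 :
  smooth_vfield X -> smooth_vfield Y -> smooth_vfield U -> smooth_vfield V ->
  let a := br (X /^\ Y) (mv_vfield U) x in
  let b := br (X /^\ Y) (mv_vfield V) x in
  br (X /^\ Y) (U /^\ V) x [:: b1; b2; b3] =
  a [:: b1; b2] * b3 (V x) - a [:: b1; b3] * b2 (V x) + a [:: b2; b3] * b1 (V x)
  - (b1 (U x) * b [:: b2; b3] - b2 (U x) * b [:: b1; b3] + b3 (U x) * b [:: b1; b2]).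
Proof.
move=> sX sY sU sV a b.
rewrite (sn_leibniz Hbr (p := 2) (q := 1) (r := 1)); last 3 first.
- exact: multivector_wedge.
- exact: multivector_vfield.
- exact: multivector_vfield.
rewrite /mv_sign /mv_lin mv_wedge2_1 mv_wedge1_2 -/a -/b.
by move: (a _) (a _) (a _) (b _) (b _) (b _) => *; ring.
Qed.

(** The value on [a, b, c] of
    [- ([U,X] /\ Y + X /\ [U,Y]) /\ V + U /\ ([V,X] /\ Y + X /\ [V,Y])],
    the expansion of the bracket of [X /\ Y] and [U /\ V] by the Leibniz rule; [W] and
    [Z] are the brackets of [X /\ Y] with [U] and with [V], and [UX] stands for the
    Lie bracket of [U] and [X]. *)
Definition lie_term (X Y U V UX UY VX VY : 'rV[R]_n)
    (a b c : dualsp (tangent R n)) : R :=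
  let W (p q : dualsp (tangent R n)) : R :=
    - ((p UX : R) * q Y - q UX * p Y + ((p X : R) * q UY - q X * p UY)) in
  let Z (p q : dualsp (tangent R n)) : R :=
    - ((p VX : R) * q Y - q VX * p Y + ((p X : R) * q VY - q X * p VY)) in
  W a b * c V - W a c * b V + W b c * a V
  - ((a U : R) * Z b c - b U * Z a c + c U * Z a b).

Lemma br_wedge X Y U V x b1 b2 b3 :
  smooth_vfield X -> smooth_vfield Y -> smooth_vfield U -> smooth_vfield V ->
  br (X /^\ Y) (U /^\ V) x [:: b1; b2; b3] =
  lie_term (X x) (Y x) (U x) (V x)
    (lie U X x) (lie U Y x) (lie V X x) (lie V Y x) b1 b2 b3.
Proof. by move=> sX sY sU sV; rewrite br_wedge2// !br_wedge1. Qed.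

Definition mv_comb (I : Type) (r : seq I) (k : R) (Q : I -> mvfield M) : mvfield M :=
  fun x l => \sum_(i <- r) k * Q i x l.

Lemma mv_comb_nil (I : Type) k (Q : I -> mvfield M) :
  mv_comb [::] k Q = fun _ _ => 0.
Proof. by apply/funext => x; apply/funext => l; rewrite /mv_comb big_nil. Qed.

Lemma mv_comb_cons (I : Type) i (r : seq I) k (Q : I -> mvfield M) :
  mv_comb (i :: r) k Q = mv_lin k (Q i) (mv_comb r k Q).
Proof. by apply/funext => x; apply/funext => l; rewrite /mv_comb big_cons. Qed.

Lemma multivector0 p : multivector p ((fun _ _ => 0) : mvfield M).
Proof.
split=> [x|c s k]; last exact: Ck_cst.
by split=> // *; rewrite mulr0 addr0.
Qed.

Lemma multivector_lin p k P Q : multivector p P -> multivector p Q ->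
  multivector p (mv_lin k P Q).
Proof.
move=> [eP sP] [eQ sQ]; split=> [x|c s j].
  have [p1 p2 p3] := eP x; have [q1 q2 q3] := eQ x.
  split=> [l sl|l1 l2 r b b'|l ul]; rewrite /mv_lin.
  - by rewrite p1// q1// mulr0 addr0.
  - by rewrite p2 q2; ring.
  - by rewrite p3// q3// mulr0 addr0.
have oi := @img_open _ _ M c.
apply: CkD => //; last exact: sQ.
by apply: CkM => //; [exact: Ck_cst|exact: sP].
Qed.

Lemma multivector_comb (I : Type) p (r : seq I) k (Q : I -> mvfield M) :
  (forall i, multivector p (Q i)) -> multivector p (mv_comb r k Q).
Proof.
move=> mQ; elim: r => [|i r IHr]; first by rewrite mv_comb_nil; exact: multivector0.
by rewrite mv_comb_cons; exact: multivector_lin.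
Qed.

Lemma br_combr (I : Type) p q (r : seq I) k P (Q : I -> mvfield M) :
  multivector p P -> (forall i, multivector q (Q i)) ->
  br P (mv_comb r k Q) = mv_comb r k (fun i => br P (Q i)).
Proof.
move=> mP mQ; elim: r => [|i r IHr].
  have E : mv_comb [::] k Q = mv_lin (- 1) (fun _ _ => 0) (fun _ _ => 0).
    by rewrite mv_comb_nil; apply/funext => x; apply/funext => l; rewrite /mv_lin mulr0 addr0.
  rewrite E (sn_linr Hbr (p := p) (q := q)) ?mv_comb_nil//; try exact: multivector0.
  by apply/funext => x; apply/funext => l; rewrite /mv_lin mulN1r addNr.
rewrite !mv_comb_cons (sn_linr Hbr (p := p) (q := q)) ?IHr//.
exact: multivector_comb.
Qed.

Lemma br_combl (I : Type) p q (r : seq I) k (P : I -> mvfield M) Q :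
  (forall i, multivector p (P i)) -> multivector q Q ->
  br (mv_comb r k P) Q = mv_comb r k (fun i => br (P i) Q).
Proof.
move=> mP mQ; rewrite (sn_antisym Hbr (p := p) (q := q))//; last exact: multivector_comb.
rewrite (@br_combr _ q p)//; apply/funext => x; apply/funext => l.
rewrite /mv_sign /mv_comb mulr_sumr; apply: eq_bigr => i _.
by rewrite (sn_antisym Hbr (mP i) mQ) /mv_sign mulrCA.
Qed.

(** The Leibniz rule gives the sum of [[P, g] /\ h Q] and [g [P, h Q]], up to
    sign; both vanish at [x]. *)
Lemma br_mul_vanishing p q P Q g h x l : multivector p P -> multivector q Q ->
  smooth_fun g -> smooth_fun h -> g x = 0 -> h x = 0 ->
  br P (mv_mul g (mv_mul h Q)) x l = 0.
Proof.
move=> mP mQ sg sh gx hx; rewrite -mv_wedge_fun.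
rewrite (sn_leibniz Hbr (p := p) (q := 0) (r := q))//; last 2 first.
- exact: multivector_fun.
- exact: multivector_mul.
rewrite mv_wedge_fun /mv_lin /mv_sign /mv_mul gx !(mul0r, mulr0) addr0 mul1r.
by rewrite /mv_wedge /wedge big1// => m _; rewrite hx mul0r mulr0.
Qed.

(** A locality property: by the choice of a factor [1 - g h], the bivector field may be
    truncated without changing its bracket with itself at [x]. *)
Lemma br_cut P g h x l : multivector 2 P ->
  smooth_fun g -> smooth_fun h -> g x = 0 -> h x = 0 ->
  let FP := mv_mul (fun z => 1 - g z * h z) P in
  br P P x l = br FP FP x l.
Proof.
move=> mP sg sh gx hx FP.
have mF : multivector 2 FP.
  apply: multivector_mul => //; apply: smooth_funB; first exact: smooth_fun_cst.
  exact: smooth_funM.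
have mgh : multivector 2 (mv_mul g (mv_mul h P)) by do 2 apply: multivector_mul => //.
have PE : P = mv_lin 1 FP (mv_mul g (mv_mul h P)).
  by apply/funext => z; apply/funext => b; rewrite /mv_lin /FP /mv_mul; ring.
have brE Q : multivector 2 Q -> br Q P x l = br Q FP x l.
  move=> mQ; rewrite {1}PE (sn_linr Hbr (p := 2) (q := 2))// /mv_lin.
  by rewrite (br_mul_vanishing l mQ mP sg sh gx hx) mul1r addr0.
rewrite brE// (sn_antisym Hbr mP mF) /mv_sign brE//.
by rewrite -signr_odd /= expr0 mul1r.
Qed.

End Bracket.
End Multivectors.

(** * Coordinate matrices of tensor fields *)

Section BilinearMatrix.
Variables (R : realType) (n : nat).
Implicit Types (A : 'M[R]_n) (u v w : 'rV[R]_n).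

Definition bilM A u v : R := (u *m A *m v^T) ord0 ord0.

Lemma bilME A u v : bilM A u v = \sum_i \sum_j u ord0 i * A i j * v ord0 j.
Proof.
rewrite /bilM !mxE exchange_big /=; apply: eq_bigr => j _.
by rewrite !mxE mulr_suml.
Qed.

Lemma bilM_tr A u v : bilM A^T u v = bilM A v u.
Proof.
rewrite !bilME exchange_big; apply: eq_bigr => i _; apply: eq_bigr => j _.
by rewrite mxE; ring.
Qed.

Lemma bilMBl A A' u v : bilM (A - A') u v = bilM A u v - bilM A' u v.
Proof. by rewrite /bilM mulmxBr mulmxBl !mxE. Qed.

Lemma bilMZl k A u v : bilM (k *: A) u v = k * bilM A u v.
Proof. by rewrite /bilM -scalemxAr -scalemxAl mxE. Qed.

End BilinearMatrix.

Section SmoothMatrix.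
Variables (R : realType) (V : normedModType R) (U : set V).
Hypothesis oU : open U.

Lemma Ck_det k m (A : V -> 'M[R]_m) : (forall i j, Ck k U (fun y => A y i j)) ->
  Ck k U (fun y => \det (A y)).
Proof.
move=> CA; rewrite /determinant; apply: Ck_sum => // s.
by apply: CkM => //; [exact: Ck_cst|exact: Ck_prod].
Qed.

(** Cramer's rule: the entries are polynomials in the entries of [A], divided by the
    determinant. *)
Lemma Ck_invmx k m (A : V -> 'M[R]_m) : (forall y, U y -> A y \in unitmx) ->
  (forall i j, Ck k U (fun y => A y i j)) ->
  forall i j, Ck k U (fun y => invmx (A y) i j).
Proof.
move=> uA CA i j.
apply: (Ck_eq (f := fun y => (\det (A y))^-1 * ((-1) ^+ (j + i) * \det (row' j (col' i (A y)))))) => //.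
  by move=> y Uy; rewrite /invmx uA// !mxE /cofactor.
apply: CkM => //; first apply: CkV => //; first by move=> y /uA; rewrite unitmxE unitfE.
  exact: Ck_det.
apply: CkM => //; first exact: Ck_cst.
apply: Ck_det => k' l; under eq_fun do rewrite !mxE; exact: CA.
Qed.

End SmoothMatrix.

Section TensorMatrix.
Variables (R : realType) (n : nat) (M : manifold R n).
Variable B : M -> 'rV[R]_n -> 'rV[R]_n -> R.
Hypotheses (HB : tensor2 B) (Bnd : nondegenerate B).
Implicit Types (c : chart M) (x : M).

Definition tens_mx c (y : 'rV[R]_n) : 'M[R]_n := \matrix_(i, j)
  B (param c y) (tvec c (param c y) (delta_mx ord0 i)) (tvec c (param c y) (delta_mx ord0 j)).

Lemma is_bilinear_suml (V : vectType R) (b : V -> V -> R) (I : Type) (r : seq I)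
    (k : I -> R) (F : I -> V) v : is_bilinear b ->
  b (\sum_(i <- r) k i *: F i) v = \sum_(i <- r) k i * b (F i) v.
Proof.
move=> [bl _]; have b0 : b 0 v = 0.
  by have := bl v (- 1) 0 0; rewrite scaler0 addr0 mulN1r addNr.
elim: r => [|i r IHr]; rewrite ?big_nil// !big_cons.
by rewrite (bl v) IHr.
Qed.

Lemma is_bilinear_sumr (V : vectType R) (b : V -> V -> R) (I : Type) (r : seq I)
    (k : I -> R) (F : I -> V) v : is_bilinear b ->
  b v (\sum_(i <- r) k i *: F i) = \sum_(i <- r) k i * b v (F i).
Proof. by move=> [bl br]; apply: (@is_bilinear_suml _ (fun u v => b v u)). Qed.

Lemma tens_mxE c x u v : dom c x ->
  B x u v = bilM (tens_mx c (coord c x)) (tcomp c x u) (tcomp c x v).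
Proof.
move=> cx; have bB := HB.1 x.
rewrite -{1}(tcompK u cx) -{1}(tcompK v cx) !(tvecE _ cx).
rewrite is_bilinear_suml// bilME; apply: eq_bigr => i _.
rewrite is_bilinear_sumr// mulr_sumr; apply: eq_bigr => j _.
by rewrite mxE coordK// -mulrA [in RHS](mulrC _ (tcomp c x v ord0 j)).
Qed.

Lemma tens_mx_smooth c i j : smooth_on (img c) (fun y => tens_mx c y i j).
Proof. by under eq_fun do rewrite mxE; exact: HB.2. Qed.

Lemma tens_mx_unit c y : img c y -> tens_mx c y \in unitmx.
Proof.
move=> iy; have cx := param_dom iy; set x := param c y in cx.
rewrite unitmxE unitfE; apply/negP => /det0P[r /eqP r0 rB]; apply: r0.
have E : hat (B x) (tvec c x r) = 0.
  apply/lfunP => v; rewrite hatE ?(tens_mxE _ _ cx); last exact: HB.1.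
  by rewrite tvecK// paramK// /bilM rB mul0mx mxE lfunE.
rewrite -(tvecK r cx); have -> : tvec c x r = 0.
  by apply: (bij_inj (Bnd x)); rewrite E linear0.
exact: derive0.
Qed.

(** The matrix of [sharp_omega] in the chart [c].  With [A] the inverse of the matrix
    of [B], this is [A *m Om *m A^T] for [Om] the matrix of the skew-symmetric part. *)
Definition poisson_mx c y : 'M[R]_n :=
  2^-1 *: ((invmx (tens_mx c y))^T - invmx (tens_mx c y)).

Lemma poisson_mx_smooth c i j : smooth_on (img c) (fun y => poisson_mx c y i j).
Proof.
move=> k; under eq_fun do rewrite !mxE.
have oi := @img_open _ _ M c.
have Ci := Ck_invmx oi (@tens_mx_unit c) (fun i j => @tens_mx_smooth c i j k).
apply: CkM => //; first exact: Ck_cst.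
by apply: CkD => //; apply: CkN.
Qed.

Definition cov c x (b : dualsp 'rV[R]_n) : 'rV[R]_n :=
  \row_i b (tvec c x (delta_mx ord0 i)).

Lemma covE c x (b : dualsp (tangent R n)) v : dom c x -> b v = (tcomp c x v *m (cov c x b)^T) ord0 ord0.
Proof.
move=> cx; rewrite -{1}(tcompK v cx) (tvecE _ cx) linear_sum mxE.
by apply: eq_bigr => i _; rewrite linearZ !mxE.
Qed.

Lemma cov_hat_inv c x (b : dualsp (tangent R n)) : dom c x ->
  tcomp c x (hat_inv (B x) b) = cov c x b *m invmx (tens_mx c (coord c x)).
Proof.
move=> cx; have u := tens_mx_unit (coord_img cx).
apply: (can_inj (mulmxK u)); rewrite mulmxKV//; apply/rowP => i.
rewrite [RHS]mxE -(hat_invE (HB.1 x) (Bnd x)) (tens_mxE _ _ cx) tvecK//.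
by rewrite /bilM trmx_delta -colE [RHS]mxE.
Qed.

(** The bivector field whose bracket with itself is conjugated by [B]. *)
Definition sharp_omega : mvfield M :=
  fun z => ext_map ((hat_tr (B z))^-1)%VF (form2 (skew_part (B z))).

Lemma sharp_omegaE c x l : dom c x -> sharp_omega x l =
  if l is [:: b1; b2] then
    bilM (poisson_mx c (coord c x)) (cov c x b1) (cov c x b2) else 0.
Proof.
move=> cx; have [bB ndB] := (HB.1 x, Bnd x).
rewrite /sharp_omega sharp_form2//; case: l => [|b1 [|b2 [|b3 l]]] //.
rewrite skew_hat_inv// (covE b1 (hat_inv (B x) b2) cx) (covE b2 (hat_inv (B x) b1) cx).
rewrite !cov_hat_inv//.
by rewrite /poisson_mx bilMZl bilMBl bilM_tr.
Qed.

Lemma sharp_omega_multivector : multivector 2 sharp_omega.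
Proof.
split=> [x|c s k]; first by apply: exterior_sharp; [exact: HB.1|exact: Bnd].
have oi := @img_open _ _ M c.
apply: (Ck_eq (f := fun y => if s is [:: i; j] then poisson_mx c y i j else 0)) => //.
  move=> y iy; have cx := param_dom iy; rewrite /= (sharp_omegaE _ cx) paramK//.
  case: s => [|i [|j [|l s]]] //=.
  have cov_dcoord p : cov c (param c y) (dcoord c (param c y) p) = delta_mx ord0 p.
    by apply/rowP => q; rewrite mxE dcoordE// tvecK// !mxE eq_sym.
  by rewrite !cov_dcoord /bilM trmx_delta -rowE -colE !mxE.
case: s => [|i [|j [|l s]]]; try exact: Ck_cst.
exact: poisson_mx_smooth.
Qed.

End TensorMatrix.

(** * The bracket of a bivector field with itself *)

Section Jacobiator.
Variables (R : realType) (n : nat) (P : 'M[R]_n) (dP : {linear 'rV[R]_n -> 'M[R]_n}).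
Hypotheses (PT : P^T = - P) (dPT : forall v, (dP v)^T = - dP v).
Local Notation covector := (dualsp (tangent R n)).
Implicit Types (a b c : covector).
Local Notation e i := (delta_mx ord0 i : 'rV[R]_n).
Local Notation Y i := (row i P).
Local Notation D k i := (row i (dP (e k))).
Local Notation DY k i := (row i (dP (Y k))).

(** With [P] the matrix of a bivector and [dP] that of its derivatives, this is
    [(D_{P(a,_)} P)(b, c)]. *)
Definition jac_term a b c : R :=
  \sum_i b (e i) * c (row i (dP (\sum_k a (e k) *: Y k))).

Lemma dual_sumZ (I : Type) (r : seq I) (k : I -> R) (F : I -> 'rV[R]_n) c :
  c (\sum_(i <- r) k i *: F i) = \sum_(i <- r) k i * c (F i).
Proof. by rewrite linear_sum; apply: eq_bigr => i _; rewrite linearZ. Qed.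

Lemma dual_row c (v : 'rV[R]_n) : c v = \sum_j v ord0 j * c (e j).
Proof. by rewrite {1}(row_sum_delta v) dual_sumZ. Qed.

Lemma jac_term_anti a b c : jac_term a c b = - jac_term a b c.
Proof.
rewrite /jac_term; set A := dP _; have AT : A^T = - A by exact: dPT.
under eq_bigr do rewrite (dual_row b) mulr_sumr.
rewrite exchange_big -sumrN; apply: eq_bigr => i _.
rewrite (dual_row c) mulr_sumr -sumrN; apply: eq_bigr => j _.
have := congr1 (fun N : 'M[R]_n => N i j) AT; rewrite !mxE => ->.
by ring.
Qed.

Lemma dual_row_sum c i (f : 'I_n -> R) (F : 'I_n -> 'rV[R]_n) :
  c (row i (dP (\sum_k f k *: F k))) = \sum_k f k * c (row i (dP (F k))).
Proof.
rewrite linear_sum.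
under [X in row i X]eq_bigr do rewrite linearZ.
rewrite linear_sum /=; under [X in c X]eq_bigr do rewrite linearZ.
exact: dual_sumZ.
Qed.

Lemma sum_jac1 a b c :
  \sum_i \sum_k a (e k) * b (e i) * c (DY k i) = jac_term a b c.
Proof.
by apply: eq_bigr => i _; rewrite dual_row_sum mulr_sumr; apply: eq_bigr => k _; ring.
Qed.

(** By skew-symmetry of [P], the vector [\sum_k c (Y k) *: e k] is [- P(c,_)]. *)
Lemma sum_jac2 a b c :
  \sum_i \sum_k a (e i) * b (D k i) * c (Y k) = - jac_term c a b.
Proof.
have YN : \sum_k c (e k) *: Y k = \sum_k - c (Y k) *: e k.
  apply/rowP => j; rewrite !summxE.
  have -> : \sum_k (- c (Y k) *: e k) ord0 j = - c (Y j).
    rewrite (bigD1 j)//= big1 => [|k kj]; first by rewrite !mxE !eqxx mulr1 addr0.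
    by rewrite !mxE [j == k]eq_sym (negbTE kj) andbF mulr0.
  rewrite (dual_row c) -sumrN; apply: eq_bigr => k _; rewrite !mxE.
  have := congr1 (fun N : 'M[R]_n => N j k) PT; rewrite !mxE => ->.
  by ring.
rewrite -sumrN /jac_term; apply: eq_bigr => i _.
rewrite YN dual_row_sum -mulrN -sumrN mulr_sumr.
by apply: eq_bigr => k _; ring.
Qed.

(** The value on [a, b, c] of the bracket of [e i /\ Y i] with [e k /\ Y k]; the
    fields [e i] commute, and their brackets with the [Y k] are derivatives of rows
    of [P]. *)
Definition bracket_term a b c (i k : 'I_n) : R :=
  lie_term (e i) (Y i) (e k) (Y k) 0 (D k i) (- D i k) (DY k i - DY i k) a b c.

(** Each bracket is an alternating sum over the permutations of [a, b, c] of two kinds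
    of monomials, which also occur with [i] and [k] exchanged; [sum_jac1] and [sum_jac2]
    evaluate the sum of each kind. *)
Lemma sum_bracket_term a b c :
  2^-1 * \sum_i (2^-1 * \sum_k bracket_term a b c i k) =
  2 * (jac_term a b c + jac_term b c a + jac_term c a b).
Proof.
pose m1 a b c i k : R := (a (e k) : R) * b (e i) * c (DY k i).
pose m2 a b c i k : R := (a (e i) : R) * b (D k i) * c (Y k).
pose alt (m : covector -> covector -> covector -> 'I_n -> 'I_n -> R) i k :=
  m a b c i k - m a c b i k + m b c a i k - m b a c i k + m c a b i k - m c b a i k.
have tE i k : bracket_term a b c i k =
    (alt m1 i k + alt m1 k i) - (alt m2 i k + alt m2 k i).
  have dB (p : covector) u v : p (u - v) = (p u : R) - p v by exact: raddfB.
  have dN (p : covector) u : p (- u) = - (p u : R) by exact: raddfN.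
  have d0 (p : covector) : p 0 = (0 : R) by exact: raddf0.
  rewrite /bracket_term /lie_term /alt /m1 /m2 !dB !dN !d0.
  by ring.
have sumalt m : \sum_i \sum_k alt m i k =
  \sum_i \sum_k m a b c i k - \sum_i \sum_k m a c b i k +
  \sum_i \sum_k m b c a i k - \sum_i \sum_k m b a c i k +
  \sum_i \sum_k m c a b i k - \sum_i \sum_k m c b a i k.
  rewrite -!(sumrB, big_split) /=; apply: eq_bigr => i _.
  by rewrite -!(sumrB, big_split).
have S m : \sum_i \sum_k (alt m i k + alt m k i) = 2 * \sum_i \sum_k alt m i k.
  under eq_bigr do rewrite big_split; rewrite big_split /=.
  by rewrite [X in _ + X]exchange_big /=; ring.
rewrite -mulr_sumr; under eq_bigr do under eq_bigr do rewrite tE.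
under eq_bigr do rewrite sumrB.
rewrite sumrB !S !sumalt !sum_jac1 !sum_jac2.
rewrite (jac_term_anti a b c) (jac_term_anti b c a) (jac_term_anti c a b).
by field.
Qed.

End Jacobiator.

Lemma derive_scale_flat (R : realType) (V : normedModType R) n (f : V -> R)
    (r : V -> 'rV[R]_n) y v :
  differentiable f y -> differentiable r y -> f y = 1 -> 'D_v f y = 0 ->
  'D_v (fun z => f z *: r z) y = 'D_v r y.
Proof.
move=> df dr f1 Df0.
have dri i j : differentiable (fun z => r z i j) y by exact: differentiable_entry.
have dfr : differentiable (fun z => f z *: r z) y.
  apply: differentiable_mx => i j; under eq_fun do rewrite mxE.
  exact: differentiableM.
apply/rowP => j; rewrite -!derive_entry; try exact: diff_derivable.
under eq_fun do rewrite mxE.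
have -> : (fun z => f z * r z ord0 j) = f * (fun z => r z ord0 j) by [].
rewrite deriveM; try exact: diff_derivable.
by rewrite f1 Df0 scaler0 addr0 scale1r.
Qed.

Lemma derive_skew (R : realType) (V : normedModType R) n (A : V -> 'M[R]_n) y v :
  differentiable A y -> (forall z, (A z)^T = - A z) ->
  ('D_v A y)^T = - 'D_v A y.
Proof.
move=> /(@diff_derivable _ _ _ _ _ v) dA AT; apply/matrixP => i j.
rewrite !mxE -!derive_entry// -deriveN; last by move/derivable_mxP: dA; apply.
congr ('D_v _ y); apply/funext => z.
by have := congr1 (fun N : 'M[R]_n => N i j) (AT z); rewrite !mxE.
Qed.

Lemma mv_combE (R : realType) n (M : manifold R n) (I : Type) (r : seq I) k
  (Q : I -> mvfield M) x l : mv_comb r k Q x l = \sum_(i <- r) k * Q i x l.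
Proof. by []. Qed.

Section BracketSharp.
Variables (R : realType) (n : nat) (M : manifold R n).
Variable br : mvfield M -> mvfield M -> mvfield M.
Hypothesis Hbr : schouten_bracket br.
Variable B : M -> 'rV[R]_n -> 'rV[R]_n -> R.
Hypotheses (HB : tensor2 B) (Bnd : nondegenerate B).
Variable x0 : M.

Local Notation c := (chart_at x0).
Local Notation y0 := (coord c x0).
Local Notation P := (poisson_mx B c).
Local Notation cx0 := (dom_chart_at x0).
Local Notation e i := (delta_mx ord0 i : 'rV[R]_n).

Let img_at : img c y0. Proof. exact/coord_img/dom_chart_at. Qed.

Lemma poisson_mx_diff : differentiable P y0.
Proof.
apply: differentiable_mx => i j; have [+ _] := poisson_mx_smooth HB Bnd c i j 1.
by apply; exact: img_at.
Qed.

Let dpoisson_linear : linear (fun v : 'rV[R]_n => 'D_v P y0).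
Proof. exact/derive_lin/poisson_mx_diff. Qed.

Definition dpoisson : {linear 'rV[R]_n -> 'M[R]_n} := HB.pack
  (fun v : 'rV[R]_n => 'D_v P y0)
  (GRing.isLinear.Build R 'rV[R]_n 'M[R]_n _ _ dpoisson_linear).

Lemma dpoissonE v : dpoisson v = 'D_v P y0.
Proof. by []. Qed.

Lemma poisson_mx_tr y : (P y)^T = - P y.
Proof.
by rewrite /poisson_mx linearZ /= linearB /= trmxK -scalerN opprB.
Qed.

Lemma dpoisson_tr v : (dpoisson v)^T = - dpoisson v.
Proof.
by rewrite !dpoissonE; apply: derive_skew; [exact: poisson_mx_diff|exact: poisson_mx_tr].
Qed.

Lemma lieE (X Y : vfield M) (f g : 'rV[R]_n -> 'rV[R]_n) :
  (forall y, img c y -> tcomp c (param c y) (X (param c y)) = f y) ->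
  (forall y, img c y -> tcomp c (param c y) (Y (param c y)) = g y) ->
  lie X Y x0 = 'D_(X x0) g y0 - 'D_(Y x0) f y0.
Proof.
move=> Xf Yg; rewrite /lie; congr (_ - _); apply: near_eq_derive.
  by have := near_img cx0; apply: filterS => y; exact: Yg.
by have := near_img cx0; apply: filterS => y; exact: Xf.
Qed.

(** Near [x0], half the sum of the [X i /\ Y i] is [sharp_omega] up to a factor which
    [br_cut] shows to be harmless, and [sum_bracket_term] adds up the brackets.  The
    cut-off function has zero derivative at [x0], so that the Lie brackets of the [X i]
    and [Y i] at [x0] are those of the uncut coordinate fields. *)
Lemma br_sharp_omega a1 a2 a3 :
  br (sharp_omega B) (sharp_omega B) x0 [:: a1; a2; a3] =
  2 * (jac_term (P y0) dpoisson a1 a2 a3 + jac_term (P y0) dpoisson a2 a3 a1 +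
       jac_term (P y0) dpoisson a3 a1 a2).
Proof.
have [chi0 [K [schi0 chi0x clK Kc chi00]]] := cutoff cx0.
(* [chi] is chosen of the form [1 - g^2] to have zero derivative at [x0]. *)
pose g z := 1 - chi0 z; pose chi z := 1 - g z * g z; pose h z := g z * (2 - g z * g z).
have sg : smooth_fun g by apply: smooth_funB => //; exact: smooth_fun_cst.
have schi : smooth_fun chi.
  by apply: smooth_funB; [exact: smooth_fun_cst|exact: smooth_funM].
have sh : smooth_fun h.
  apply: smooth_funM => //; apply: smooth_funB; first exact: smooth_fun_cst.
  exact: smooth_funM.
have gx : g x0 = 0 by rewrite /g chi0x subrr.
have hx : h x0 = 0 by rewrite /h gx mul0r.
have chix : chi x0 = 1 by rewrite /chi gx mulr0 subr0.
have chiK z : ~ K z -> chi z = 0 by move=> /chi00 z0; rewrite /chi /g z0; ring.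
have Fchi z : 1 - g z * h z = chi z * chi z by rewrite /h /chi; ring.
pose X i : vfield M := fun z => (chi z * 1) *: tvec c z (e i).
pose Y i : vfield M := fun z =>
  \sum_j (chi z * P (coord c z) i j) *: tvec c z (e j).
have sX i : smooth_vfield (X i).
  by apply: (smooth_cut_field (a := fun=> 1) i schi clK Kc chiK) => k; exact: Ck_cst.
have sY i : smooth_vfield (Y i).
  apply: smooth_vfield_sum => j; apply: (smooth_cut_field (a := fun y => P y i j) j schi clK Kc chiK).
  exact: poisson_mx_smooth.
have mQ i : multivector 2 (mv_wedge (mv_vfield (X i)) (mv_vfield (Y i))).
  exact: multivector_wedge.
have mS := sharp_omega_multivector HB Bnd.
(* [1 - g h] is the product of the cut-off factors in [X i] and [Y i]. *)
have FPE : mv_mul (fun z => 1 - g z * h z) (sharp_omega B) =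
    mv_comb (index_enum 'I_n) 2^-1 (fun i => mv_wedge (mv_vfield (X i)) (mv_vfield (Y i))).
  apply/funext => z; apply/funext => l; rewrite /mv_mul /mv_comb Fchi.
  have [cz|ncz] := pselect (dom c z); last first.
    have z0 : chi z = 0 by apply: chiK => /Kc.
    rewrite z0 mulr0 mul0r big1// => i _.
    have X0 : X i z = 0 by rewrite /X z0 mul0r scale0r.
    rewrite /mv_wedge (wedge1_1E (X i z) (Y i z)) X0.
    by case: l => [|b1 [|b2 [|b3 l]]]; rewrite ?linear0 ?mul0r ?subr0 ?mulr0.
  rewrite (sharp_omegaE HB Bnd _ cz).
  under eq_bigr do rewrite /mv_wedge (wedge1_1E (X _ z) (Y _ z)).
  case: l => [|b1 [|b2 [|b3 l]]]; try by rewrite ?mulr0 big1// => i _; rewrite mulr0.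
  have bX (b : dualsp (tangent R n)) i : b (X i z) = chi z * cov c z b ord0 i.
    by rewrite /X mulr1 [LHS]linearZ mxE.
  have bY (b : dualsp (tangent R n)) i :
      b (Y i z) = chi z * \sum_j P (coord c z) i j * cov c z b ord0 j.
    rewrite /Y dual_sumZ mulr_sumr; apply: eq_bigr => j _.
    by rewrite [cov _ _ _ _ _]mxE mulrA.
  have PN u v : bilM (P (coord c z)) v u = - bilM (P (coord c z)) u v.
    by rewrite -bilM_tr poisson_mx_tr /bilM mulmxN mulNmx mxE.
  under eq_bigr do rewrite !bX !bY; rewrite -mulr_sumr sumrB.
  have bil b b' : \sum_i chi z * cov c z b ord0 i * (chi z *
        \sum_j P (coord c z) i j * cov c z b' ord0 j) =
      chi z * chi z * bilM (P (coord c z)) (cov c z b) (cov c z b').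
    rewrite bilME mulr_sumr; apply: eq_bigr => i _.
    rewrite !mulr_sumr; apply: eq_bigr => j _.
    by move: (P _ i j) => p; ring.
  rewrite !bil (PN (cov c z b1)).
  by field.
rewrite (br_cut Hbr _ mS sg sh gx hx) FPE.
rewrite (br_combl Hbr (p := 2) (q := 2))//; last exact: multivector_comb.
rewrite mv_combE; under eq_bigr do rewrite (br_combr Hbr (p := 2) (q := 2))// mv_combE.
rewrite -(sum_bracket_term (poisson_mx_tr y0) dpoisson_tr) mulr_sumr.
apply: eq_bigr => i _; congr (_ * _); rewrite mulr_sumr; apply: eq_bigr => k _.
congr (_ * _).
have row_entry (A : 'M[R]_n) p q r : row p A r q = A p q by rewrite mxE.
have Xx j : X j x0 = e j by rewrite /X chix mulr1 scale1r tvec_at.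
have Yx j : Y j x0 = row j (P y0).
  rewrite /Y chix [RHS]row_sum_delta; apply: eq_bigr => l _.
  by rewrite mul1r tvec_at row_entry.
pose G y := chi (param c y).
have locX j y : img c y -> tcomp c (param c y) (X j (param c y)) = G y *: e j.
  by move=> iy; have cy := param_dom iy; rewrite tcompZ// mulr1 tvecK.
have locY j y : img c y -> tcomp c (param c y) (Y j (param c y)) = G y *: row j (P y).
  move=> iy; have cy := param_dom iy; rewrite tcomp_sum// [X in _ *: X]row_sum_delta.
  rewrite scaler_sumr; apply: eq_bigr => l _.
  by rewrite tcompZ// tvecK// paramK// scalerA row_entry.
have dG : differentiable G y0 by have [+ _] := schi c 1; apply; exact: img_at.
have G1 : G y0 = 1 by rewrite /G coordK//; exact: cx0.
have DG v : 'D_v G y0 = 0.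
  have dg : derivable (g \o param c) y0 v.
    by apply: diff_derivable; have [+ _] := sg c 1; apply; exact: img_at.
  have -> : G = cst 1 - (g \o param c) * (g \o param c) by [].
  rewrite deriveB; [|exact: derivable_cst|exact: derivableM].
  have g0 : (g \o param c) y0 = 0 by rewrite /= coordK//; exact: cx0.
  by rewrite (deriveM dg dg) g0 !scale0r derive_cst addr0 subr0.
have DX j v : 'D_v (fun y => G y *: e j) y0 = 0.
  by rewrite derive_scale_flat// derive_cst.
have DY j v : 'D_v (fun y => G y *: row j (P y)) y0 = row j (dpoisson v).
  have dr : differentiable (fun y => row j (P y)) y0.
    apply: differentiable_mx => p q; under eq_fun do rewrite row_entry.
    by apply: differentiable_entry; exact: poisson_mx_diff.
  rewrite derive_scale_flat// dpoissonE; apply/rowP => q.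
  rewrite -derive_entry; last exact: diff_derivable.
  under eq_fun do rewrite row_entry.
  rewrite derive_entry ?row_entry//; exact/diff_derivable/poisson_mx_diff.
have lXX : lie (X k) (X i) x0 = 0 by rewrite (lieE (locX k) (locX i)) !DX subr0.
have lXY : lie (X k) (Y i) x0 = row i (dpoisson (e k)).
  by rewrite (lieE (locX k) (locY i)) DX DY Xx subr0.
have lYX : lie (Y k) (X i) x0 = - row k (dpoisson (e i)).
  by rewrite (lieE (locY k) (locX i)) DX DY Xx sub0r.
have lYY : lie (Y k) (Y i) x0 = row i (dpoisson (row k (P y0))) - row k (dpoisson (row i (P y0))).
  by rewrite (lieE (locY k) (locY i)) !DY !Yx.
by rewrite (br_wedge Hbr)// lXX lXY lYX lYY !Xx !Yx.
Qed.

End BracketSharp.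

(** * Differentiating the bivector along a vector *)

Section DeriveBilinear.
Variables (R : realType) (V : normedModType R) (n : nat).
Implicit Types (A : V -> 'M[R]_n) (u v : V -> 'rV[R]_n).

Lemma differentiable_sumf m (f : 'I_m -> V -> R) (x : V) :
  (forall i, differentiable (f i) x) -> differentiable (fun y => \sum_i f i y) x.
Proof.
move=> df; have -> : (fun y => \sum_i f i y) = \sum_i f i.
  by apply/funext => y; rewrite fct_sumE.
exact: differentiable_sum.
Qed.

Lemma derive_sumf m (f : 'I_m -> V -> R) (x w : V) :
  (forall i, differentiable (f i) x) ->
  'D_w (fun y => \sum_i f i y) x = \sum_i 'D_w (f i) x.
Proof.
move=> df; have -> : (fun y => \sum_i f i y) = \sum_i f i.
  by apply/funext => y; rewrite fct_sumE.
by rewrite derive_sum// => i; exact: diff_derivable.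
Qed.

Lemma differentiable_mulmx m p q (A : V -> 'M[R]_(m, p)) (A' : V -> 'M[R]_(p, q)) x :
  differentiable A x -> differentiable A' x ->
  differentiable (fun y => A y *m A' y) x.
Proof.
move=> dA dA'; apply: differentiable_mx => i j; under eq_fun do rewrite mxE.
apply: differentiable_sumf => k.
by apply: differentiableM; exact: differentiable_entry.
Qed.

Lemma differentiable_bilM A u v x :
  differentiable A x -> differentiable u x -> differentiable v x ->
  differentiable (fun y => bilM (A y) (u y) (v y)) x.
Proof.
move=> dA du dv; under eq_fun do rewrite bilME.
do 2 apply: differentiable_sumf => ?.
by apply: differentiableM; first apply: differentiableM; exact: differentiable_entry.
Qed.

Lemma derive_bilM A u v x w :
  differentiable A x -> differentiable u x -> differentiable v x ->
  'D_w (fun y => bilM (A y) (u y) (v y)) x =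
  bilM ('D_w A x) (u x) (v x) + bilM (A x) ('D_w u x) (v x) +
  bilM (A x) (u x) ('D_w v x).
Proof.
move=> dA du dv.
have dAij i j : differentiable (fun y => A y i j) x by exact: differentiable_entry.
have dui i : differentiable (fun y => u y ord0 i) x by exact: differentiable_entry.
have dvi i : differentiable (fun y => v y ord0 i) x by exact: differentiable_entry.
have dm i j : differentiable (fun y => u y ord0 i * A y i j * v y ord0 j) x.
  by do 2 apply: differentiableM => //.
under eq_fun do rewrite bilME.
rewrite derive_sumf => [|i]; last exact: differentiable_sumf.
rewrite !bilME -!big_split; apply: eq_bigr => i _ /=.
rewrite derive_sumf// -!big_split; apply: eq_bigr => j _ /=.
have -> : (fun y => u y ord0 i * A y i j * v y ord0 j) =
  (fun y => u y ord0 i) * (fun y => A y i j) * (fun y => v y ord0 j) by [].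
rewrite deriveM; try exact: diff_derivable; last first.
  by apply: derivableM; exact: diff_derivable.
rewrite deriveM; try exact: diff_derivable.
rewrite !derive_entry; try exact: diff_derivable.
by rewrite /GRing.scale /= fctE; ring.
Qed.

Lemma derive_dot u v x w : differentiable u x -> differentiable v x ->
  'D_w (fun y => bilM 1%:M (u y) (v y)) x =
  bilM 1%:M ('D_w u x) (v x) + bilM 1%:M (u x) ('D_w v x).
Proof.
move=> du dv; rewrite (derive_bilM w (differentiable_cst (1%:M : 'M[R]_n) x) du dv).
by rewrite derive_cst {1}/bilM mulmx0 mul0mx [X in X + _ + _]mxE add0r.
Qed.

End DeriveBilinear.

Section DeriveBivector.
Variables (R : realType) (V : normedModType R) (n : nat).
Variables (P Om : V -> 'M[R]_n) (al be : V -> 'rV[R]_n) (x w : V).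
Hypotheses (dP : differentiable P x) (dOm : differentiable Om x).
Hypotheses (dal : differentiable al x) (dbe : differentiable be x).
Hypotheses (PT : forall y, (P y)^T = - P y) (OmT : forall y, (Om y)^T = - Om y).
Hypothesis OmP : \forall y \near x,
  bilM (Om y) (al y *m P y) (be y *m P y) = bilM (P y) (al y) (be y).

Let hal y := - (al y *m P y).
Let hbe y := - (be y *m P y).

Lemma bilM_skew (A : 'M[R]_n) (u v : 'rV[R]_n) : A^T = - A ->
  bilM A v u = - bilM A u v.
Proof. by move=> AT; rewrite -bilM_tr AT /bilM mulmxN mulNmx mxE. Qed.

Lemma bilMNN (A : 'M[R]_n) (u v : 'rV[R]_n) : bilM A (- u) (- v) = bilM A u v.
Proof. by rewrite /bilM linearN mulmxN !mulNmx opprK. Qed.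

Lemma dot_hor (A : 'M[R]_n) (u v : 'rV[R]_n) : A^T = - A ->
  bilM 1%:M u (- (v *m A)) = bilM A u v.
Proof. by move=> AT; rewrite /bilM mulmx1 linearN /= trmx_mul AT mulNmx opprK mulmxA. Qed.

(** In the application [al] and [be] are the components of [B(Y,_)] and [B(Z,_)], so
    that [hal] and [hbe] are the horizontal parts of [Y] and [Z].  The function
    [omega(Y, Z)] has the three expressions [P(al, be)], [al . hbe = - be . hal] and
    [Om(hal, hbe)]; the identity is a combination of their derivatives. *)
Lemma derive_bivector_split :
  - bilM ('D_w P x) (al x) (be x) =
  bilM ('D_w Om x) (hal x) (hbe x)
  + (bilM 1%:M (be x) ('D_w hal x) - bilM (Om x) (hbe x) ('D_w hal x))
  - (bilM 1%:M (al x) ('D_w hbe x) - bilM (Om x) (hal x) ('D_w hbe x)).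
Proof.
have dhal : differentiable hal x by apply/differentiableN/differentiable_mulmx.
have dhbe : differentiable hbe x by apply/differentiableN/differentiable_mulmx.
pose W : R := 'D_w (fun y => bilM (P y) (al y) (be y)) x.
have E1 : W = bilM 1%:M ('D_w al x) (hbe x) + bilM 1%:M (al x) ('D_w hbe x).
  transitivity ('D_w (fun y => bilM 1%:M (al y) (hbe y)) x).
    by congr ('D_w _ x); apply/funext => y; rewrite dot_hor.
  exact: derive_dot.
have E2 : - W = bilM 1%:M ('D_w be x) (hal x) + bilM 1%:M (be x) ('D_w hal x).
  transitivity ('D_w (fun y => bilM 1%:M (be y) (hal y)) x).
    rewrite /W -deriveN; last first.
      by apply: diff_derivable; exact: (differentiable_bilM dP dal dbe).
    congr ('D_w _ x); apply/funext => y; rewrite dot_hor//.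
    by rewrite (bilM_skew _ _ (PT y)).
  exact: derive_dot.
have E3 : W = bilM ('D_w Om x) (hal x) (hbe x) + bilM (Om x) ('D_w hal x) (hbe x)
    + bilM (Om x) (hal x) ('D_w hbe x).
  rewrite -derive_bilM//; apply: near_eq_derive; apply: filterS OmP => y.
  by rewrite bilMNN.
have E4 : W = bilM ('D_w P x) (al x) (be x) + bilM (P x) ('D_w al x) (be x) +
    bilM (P x) (al x) ('D_w be x) by rewrite -derive_bilM.
move: E1 E2 E3 E4; rewrite !dot_hor// (bilM_skew (al x) _ (PT x)).
rewrite (bilM_skew ('D_w hal x) _ (OmT x)).
move: W (bilM (P x) ('D_w al x) _) (bilM 1%:M (al x) _) (bilM (P x) (al x) ('D_w be x))
  (bilM 1%:M (be x) _) (bilM ('D_w Om x) _ _) (bilM (Om x) ('D_w hal x) _)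
  (bilM (Om x) _ ('D_w hbe x)) (bilM ('D_w P x) _ _) => W t1 t2 t3 t4 t5 t6 t7 t8.
lra.
Qed.

End DeriveBivector.

(** * Horizontal and vertical parts *)

Section Splitting.
Variables (R : realType) (V : vectType R) (b : V -> V -> R).
Hypothesis bB : is_bilinear b.

Lemma is_bilinear_sym : is_bilinear (sym_part b).
Proof.
have [bl br] := bB; split=> v k x y; rewrite /sym_part.
  by rewrite [b (_ + _) _](bl v) [b _ (_ + _)](br v) /GRing.scale /=; ring.
by rewrite [b (_ + _) _](bl v) [b _ (_ + _)](br v) /GRing.scale /=; ring.
Qed.

Lemma is_bilinear_skew : is_bilinear (skew_part b).
Proof.
have [bl br] := bB; split=> v k x y; rewrite /skew_part.
  by rewrite [b (_ + _) _](bl v) [b _ (_ + _)](br v) /GRing.scale /=; ring.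
by rewrite [b (_ + _) _](bl v) [b _ (_ + _)](br v) /GRing.scale /=; ring.
Qed.

Lemma kerP (w : V -> V -> R) u t : is_bilinear w -> u \in ker w -> w u t = 0.
Proof. by move=> bw; rewrite memv_ker => /eqP u0; rewrite -hatE// u0 lfunE. Qed.

Local Notation H := (ker (sym_part b)).
Local Notation N := (ker (skew_part b)).
Hypotheses (dHN : directv (H + N)) (fHN : (H + N)%VS = fullv).

Let hor := daddv_pi H N.
Let ver := daddv_pi N H.

Lemma hor_ver w : hor w + ver w = w.
Proof. by apply: daddv_pi_add; [exact: directv_addP|rewrite fHN memvf]. Qed.

Lemma sym_hor w t : sym_part b (hor w) t = 0.
Proof. by apply: kerP; [exact: is_bilinear_sym|exact: memv_pi]. Qed.

Lemma skew_ver w t : skew_part b (ver w) t = 0.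
Proof. by apply: kerP; [exact: is_bilinear_skew|exact: memv_pi]. Qed.

Lemma bilinearDl u v t : b (u + v) t = b u t + b v t.
Proof. by have := bB.1 t 1 u v; rewrite scale1r /GRing.scale /= mul1r. Qed.

Lemma bilinearDr u v t : b t (u + v) = b t u + b t v.
Proof. by have := bB.2 t 1 u v; rewrite scale1r /GRing.scale /= mul1r. Qed.

Lemma splitl w t : b w t = b (hor w) t + b (ver w) t.
Proof. by rewrite -bilinearDl hor_ver. Qed.

Lemma splitr w t : b t w = b t (hor w) + b t (ver w).
Proof. by rewrite -bilinearDr hor_ver. Qed.

(** Transposing [B] changes its sign on horizontal vectors and preserves it on vertical
    ones. *)
Lemma hor_transpose w t : b w t = b t w - 2 * b t (hor w).
Proof.
move: (sym_hor w t) (skew_ver w t); rewrite /sym_part /skew_part.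
by rewrite (splitl w) (splitr w); lra.
Qed.

Lemma skew_hor u v : skew_part b (hor u) (hor v) = skew_part b u v.
Proof.
have skewl p q : skew_part b p q = skew_part b (hor p) q.
  rewrite /skew_part (splitl p q) (splitr p q); have := skew_ver p q.
  by rewrite /skew_part; lra.
have skewC p q : skew_part b p q = - skew_part b q p by rewrite /skew_part; lra.
by rewrite (skewl u v) skewC (skewC (hor u) v) (skewl v).
Qed.

(** Both sides are the value on [l] of the part of [B(w,_)] which comes from the
    vertical part of [w]. *)
Lemma sym_ver l w : sym_part b l (ver w) = b w l - skew_part b (hor w) l.
Proof.
move: (sym_hor w l) (skew_ver w l); rewrite /sym_part /skew_part.
by rewrite (splitl w); lra.
Qed.

End Splitting.

Section HorizontalChart.
Variables (R : realType) (n : nat) (M : manifold R n).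
Variable B : M -> 'rV[R]_n -> 'rV[R]_n -> R.
Hypotheses (HB : tensor2 B) (Bnd : nondegenerate B).
Local Notation H x := (ker (sym_part (B x))).
Local Notation N x := (ker (skew_part (B x))).
Hypothesis HN : forall x : M, directv (H x + N x) /\ (H x + N x)%VS = fullv.

Definition skew_mx (c : chart M) y : 'M[R]_n :=
  2^-1 *: (tens_mx B c y - (tens_mx B c y)^T).

Lemma skew_mx_tr c y : (skew_mx c y)^T = - skew_mx c y.
Proof. by rewrite /skew_mx linearZ /= linearB /= trmxK -scalerN opprB. Qed.

Lemma skew_mxE c x u v : dom c x ->
  skew_part (B x) u v = bilM (skew_mx c (coord c x)) (tcomp c x u) (tcomp c x v).
Proof.
move=> cx; rewrite /skew_part (tens_mxE HB u v cx) (tens_mxE HB v u cx).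
by rewrite /skew_mx bilMZl bilMBl bilM_tr.
Qed.

(** By [hor_transpose], [w B = (w - 2 h) B^T] in coordinates, with [h] the horizontal
    part of [w]; multiply by the inverse of [B^T]. *)
Lemma tcomp_hor c x w : dom c x ->
  tcomp c x (daddv_pi (H x) (N x) w) =
  - (tcomp c x w *m tens_mx B c (coord c x) *m poisson_mx B c (coord c x)).
Proof.
move=> cx; have [dHN fHN] := HN x.
have uA := tens_mx_unit HB Bnd (coord_img cx); set A := tens_mx B c _ in uA *.
set h := daddv_pi _ _ _; pose k := tcomp c x w - 2 *: tcomp c x h.
have AT : tcomp c x w *m A = k *m A^T.
  have colE (A' : 'M[R]_n) u j : (u *m A') ord0 j = bilM A' u (delta_mx ord0 j).
    by rewrite /bilM trmx_delta -colE [RHS]mxE.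
  apply/rowP => j; rewrite !colE bilM_tr -(tvecK (delta_mx ord0 j) cx).
  have -> : bilM A (tcomp c x (tvec c x (delta_mx ord0 j))) k =
      B x (tvec c x (delta_mx ord0 j)) w - 2 * B x (tvec c x (delta_mx ord0 j)) h.
    rewrite !(tens_mxE HB _ _ cx) /k -/A.
    move: (tcomp c x w) (tcomp c x h) (tcomp c x _) => w' h' e.
    by rewrite /bilM linearB linearZ /= mulmxBr -scalemxAr !mxE.
  by rewrite -(tens_mxE HB _ _ cx) (hor_transpose (HB.1 x) dHN fHN).
have uAT : A^T \in unitmx by rewrite unitmx_tr.
rewrite /poisson_mx -/A -scalemxAr mulmxBr mulmxK// trmx_inv AT mulmxK//.
rewrite /k; move: (tcomp c x w) (tcomp c x h) => w' h'.
by rewrite addrAC subrr add0r scalerN opprK scalerA mulVf ?scale1r// pnatr_eq0.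
Qed.

(** In matrices, [B P B^T] is the skew-symmetric part of [B]. *)
Lemma skew_poisson c x u v : dom c x ->
  let A := tens_mx B c (coord c x) in
  bilM (poisson_mx B c (coord c x)) (u *m A) (v *m A) =
  bilM (skew_mx c (coord c x)) u v.
Proof.
move=> cx A; have uA : A \in unitmx := tens_mx_unit HB Bnd (coord_img cx).
have uAT : A^T \in unitmx by rewrite unitmx_tr.
rewrite /bilM /poisson_mx /skew_mx -/A trmx_mul; congr (_ _ ord0 ord0).
rewrite -!scalemxAr -!scalemxAl; congr (_ *: _).
by rewrite trmx_inv mulmxBr mulmxK// mulmxA mulmxBl mulmxKV// -mulmxBr.
Qed.

End HorizontalChart.

(** * Both sides in one chart *)

Lemma cyclic_sum (R : realType) n (Au Av Aw : 'M[R]_n) (u v w : 'rV[R]_n) :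
  Av^T = - Av ->
  (-1) ^+ 0 * bilM Au v w + ((-1) ^+ 1 * bilM Av u w + ((-1) ^+ 2 * bilM Aw u v + 0)) =
  bilM Au v w + bilM Av w u + bilM Aw u v.
Proof.
move=> AvT; rewrite (bilM_skew u w AvT).
by rewrite expr0 expr1 sqrrN expr1n !mul1r mulN1r addr0 addrA.
Qed.

Lemma is_bilinear_subl (R : realType) (V : vectType R) (b : V -> V -> R) l l' v :
  is_bilinear b -> b (l - l') v = b l v - b l' v.
Proof.
by move=> [bl _]; rewrite addrC -scaleN1r bl /GRing.scale /= mulN1r addrC.
Qed.

Lemma regroup (R : realType) (a b c s1 s2 s3 s4 s5 s6 : R) :
  a + s1 - s2 + (b + s3 - s4) + (c + s5 - s6) =
  a + b + c + (s1 - s4) + (s3 - s6) + (s5 - s2).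
Proof. by ring. Qed.

Section Assembly.
Variables (R : realType) (n : nat) (M : manifold R n).
Variable B : M -> 'rV[R]_n -> 'rV[R]_n -> R.
Hypotheses (HB : tensor2 B) (Bnd : nondegenerate B).
Local Notation H x := (ker (sym_part (B x))).
Local Notation N x := (ker (skew_part (B x))).
Hypothesis HN : forall x : M, directv (H x + N x) /\ (H x + N x)%VS = fullv.
Variable x : M.
Local Notation c := (chart_at x).
Local Notation y0 := (coord c x).
Definition hor (W : vfield M) : vfield M := fun z => daddv_pi (H z) (N z) (W z).
Definition ver (W : vfield M) : vfield M := fun z => daddv_pi (N z) (H z) (W z).
Local Notation P := (poisson_mx B c).
Local Notation dP := (dpoisson HB Bnd x).
Local Notation Om := (skew_mx B c).

Let cx : dom c x. Proof. exact: dom_chart_at. Qed.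
Let iy0 : img c y0. Proof. exact/coord_img/cx. Qed.

Definition loc (X : vfield M) y := tcomp c (param c y) (X (param c y)).

(** The components of [B(X,_)]. *)
Definition loc_lower X y := loc X y *m tens_mx B c y.
Definition loc_hor X y := - (loc_lower X y *m P y).

Lemma loc_horE X y : img c y -> tcomp c (param c y) (hor X (param c y)) = loc_hor X y.
Proof. by move=> iy; rewrite (tcomp_hor HB Bnd HN (X (param c y)) (param_dom iy)) paramK. Qed.

Lemma loc_hor_at X : loc_hor X y0 = hor X x.
Proof. by rewrite -loc_horE// coordK// tcomp_at. Qed.

Lemma loc_lower_diff X : smooth_vfield X -> differentiable (loc_lower X) y0.
Proof.
move=> sX; apply: differentiable_mulmx.
  by have [+ _] := sX c 1; rewrite setIT; apply.
by apply: differentiable_mx => i j; have [+ _] := tens_mx_smooth HB c i j 1; apply.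
Qed.

Lemma skew_mx_diff : differentiable Om y0.
Proof.
have dT i j : differentiable (fun y => tens_mx B c y i j) y0.
  by have [+ _] := tens_mx_smooth HB c i j 1; apply.
have E y i j : Om y i j = 2^-1 * (tens_mx B c y i j - tens_mx B c y j i).
  by rewrite /skew_mx; move: (tens_mx B c y) => A; rewrite !mxE.
apply: differentiable_mx => i j; under eq_fun do rewrite E.
by apply: differentiableM; [exact: differentiable_cst|exact: differentiableB].
Qed.

Definition lower (X : vfield M) : dualsp (tangent R n) :=
  (bidual _ (X x) \o hat_tr (B x))%VF.

Lemma lowerE X v : lower X v = B x (X x) v.
Proof. by rewrite comp_lfunE bidualE hat_trE//; exact: HB.1. Qed.

Lemma lower_basis X i : lower X (delta_mx ord0 i) = loc_lower X y0 ord0 i.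
Proof.
rewrite lowerE (tens_mxE HB _ _ cx) !tcomp_at /loc_lower /loc coordK// tcomp_at.
by rewrite /bilM trmx_delta -colE [LHS]mxE.
Qed.

Lemma lower_pair X l : lower X l = bilM 1%:M (loc_lower X y0) l.
Proof.
rewrite dual_row /bilM mulmx1 mxE; apply: eq_bigr => j _.
by rewrite lower_basis !mxE mulrC.
Qed.

(** The vector [P(B(X,_), _)] is minus the horizontal part of [X]. *)
Lemma jac_lower X Y Z : jac_term (P y0) dP (lower X) (lower Y) (lower Z) =
  - bilM ('D_(hor X x) P y0) (loc_lower Y y0) (loc_lower Z y0).
Proof.
rewrite /jac_term -loc_hor_at.
have -> : \sum_k lower X (delta_mx ord0 k) *: row k (P y0) = - loc_hor X y0.
  rewrite /loc_hor opprK mulmx_sum_row; apply: eq_bigr => k _.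
  by rewrite lower_basis.
have -> : dP (- loc_hor X y0) = - 'D_(loc_hor X y0) P y0 by exact: linearN.
move: ('D_(loc_hor X y0) P y0) => A; rewrite bilME -sumrN; apply: eq_bigr => i _.
rewrite lower_basis dual_row mulr_sumr -sumrN; apply: eq_bigr => j _.
by rewrite lower_basis; move: (loc_lower Y y0) (loc_lower Z y0) => u v; rewrite !mxE; ring.
Qed.

(** [derive_bivector_split], where [sym_ver] identifies the contractions with the
    values of [S] on vertical vectors. *)
Lemma jac_lower_split X Y Z : smooth_vfield Y -> smooth_vfield Z ->
  let U := hor X x in
  jac_term (P y0) dP (lower X) (lower Y) (lower Z) =
  bilM ('D_U Om y0) (hor Y x) (hor Z x)
  + sym_part (B x) ('D_U (loc_hor Y) y0) (ver Z x)
  - sym_part (B x) ('D_U (loc_hor Z) y0) (ver Y x).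
Proof.
move=> sY sZ U; have [dHN fHN] := HN x; have bB := HB.1 x.
have sE L W : sym_part (B x) L (ver W x) =
    bilM 1%:M (loc_lower W y0) L - bilM (Om y0) (loc_hor W y0) L.
  rewrite /ver (sym_ver bB dHN fHN) -lowerE lower_pair; congr (_ - _).
  by rewrite (skew_mxE HB _ _ cx) !tcomp_at loc_hor_at.
have OmP : \forall y \near y0, bilM (Om y) (loc_lower Y y *m P y) (loc_lower Z y *m P y) =
    bilM (P y) (loc_lower Y y) (loc_lower Z y).
  have := near_img cx; apply: filterS => y iy; have cy := param_dom iy.
    transitivity (bilM (Om y) (loc_hor Y y) (loc_hor Z y)).
      by rewrite /loc_hor bilMNN.
    set z := param c y in cy.
    have e1 := skew_mxE HB (hor Y z) (hor Z z) cy.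
    have e2 := skew_mxE HB (Y z) (Z z) cy.
    have e3 := skew_poisson HB Bnd (loc Y y) (loc Z y) cy.
    rewrite paramK// in e1 e2 e3.
    rewrite -(loc_horE Y iy) -(loc_horE Z iy).
    apply: etrans (esym e1) _; apply: etrans _ (esym e3); apply: etrans _ e2.
    by apply: skew_hor; [exact: HB.1|exact: (HN z).1|exact: (HN z).2].
apply: etrans (jac_lower X Y Z) _.
apply: etrans (derive_bivector_split U (poisson_mx_diff HB Bnd x) skew_mx_diff
  (loc_lower_diff sY) (loc_lower_diff sZ) (poisson_mx_tr B x) (skew_mx_tr B c) OmP) _.
congr (_ + _ - _); [|exact/esym/sE|exact/esym/sE].
by congr (bilM _ _ _); exact: loc_hor_at.
Qed.

Lemma ext_deriv_omega u v w :
  form_eval (ext_deriv (fun z => form2 (skew_part (B z))) x) [:: u; v; w] =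
  bilM ('D_u Om y0) v w + bilM ('D_v Om y0) w u + bilM ('D_w Om y0) u v.
Proof.
rewrite /ext_deriv form_eval_form /= !big_ord_recl big_ord0 /=.
have D p q r : 'D_p (fun y : 'rV[R]_n => form_eval (form2 (skew_part (B (param c y))))
    [:: tvec c (param c y) q; tvec c (param c y) r] : R) y0 = bilM ('D_p Om y0) q r.
  transitivity ('D_p (fun y => bilM (Om y) q r) y0).
    apply: near_eq_derive; have := near_img cx; apply: filterS => y iy.
    have cy := param_dom iy.
    have := skew_mxE HB (tvec c (param c y) q) (tvec c (param c y) r) cy.
    by rewrite (tvecK q cy) (tvecK r cy) (paramK iy) /form2 form_eval_form => <-.
  rewrite (derive_bilM p skew_mx_diff (differentiable_cst q _) (differentiable_cst r _)).
  rewrite !derive_cst /bilM linear0 mulmx0 !mul0mx.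
  have z0 : (0 : 'M[R]_1) ord0 ord0 = 0 by rewrite mxE.
  by rewrite z0 !addr0.
apply: etrans (cyclic_sum _ _ u v w (derive_skew v skew_mx_diff (@skew_mx_tr _ _ _ B c))).
by congr (_ * _ + (_ * _ + (_ * _ + 0))); exact: D.
Qed.

Lemma sym_lie_hor X Y Z :
  sym_part (B x) (lie (hor X) (hor Y) x) (ver Z x) =
  sym_part (B x) ('D_(hor X x) (loc_hor Y) y0) (ver Z x)
  - sym_part (B x) ('D_(hor Y x) (loc_hor X) y0) (ver Z x).
Proof.
rewrite (lieE (@loc_horE X) (@loc_horE Y)).
exact: is_bilinear_subl (is_bilinear_sym (HB.1 x)).
Qed.

End Assembly.

Theorem theorem4p3 (R : realType) (n : nat) (M : manifold R n)
  (br : mvfield M -> mvfield M -> mvfield M) (Hbr : schouten_bracket br)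
  (B : M -> 'rV[R]_n -> 'rV[R]_n -> R) (HB : tensor2 B)
  (Bnondeg : nondegenerate B) :
  let omega x := skew_part (B x) in
  let S x := sym_part (B x) in
  let H x := ker (S x) in
  let V x := ker (omega x) in
  let omega_form : formfield M := fun x => form2 (omega x) in
  subbundle H -> subbundle V ->
  (forall x : M, directv (H x + V x) /\ (H x + V x)%VS = fullv) ->
  forall X Y Z : vfield M,
  smooth_vfield X -> smooth_vfield Y -> smooth_vfield Z ->
  let hor (W : vfield M) : vfield M := fun x => daddv_pi (H x) (V x) (W x) in
  let ver (W : vfield M) : vfield M := fun x => daddv_pi (V x) (H x) (W x) in
  forall x : M,
  2^-1 * form_eval (conj_bracket br B omega_form omega_form x) [:: X x; Y x; Z x] =
    form_eval (ext_deriv omega_form x) [:: hor X x; hor Y x; hor Z x]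
    + S x (lie (hor X) (hor Y) x) (ver Z x)
    + S x (lie (hor Y) (hor Z) x) (ver X x)
    + S x (lie (hor Z) (hor X) x) (ver Y x).
Proof.
move=> omega S H V omega_form _ _ HN X Y Z sX sY sZ hor' ver' x.
have conjE : form_eval (conj_bracket br B omega_form omega_form x) [:: X x; Y x; Z x] =
    br (sharp_omega B) (sharp_omega B) x [:: lower B x X; lower B x Y; lower B x Z] by [].
rewrite conjE (br_sharp_omega Hbr HB Bnondeg) mulKf ?pnatr_eq0//.
have JX := jac_lower_split HB Bnondeg HN x X sY sZ.
have JY := jac_lower_split HB Bnondeg HN x Y sZ sX.
have JZ := jac_lower_split HB Bnondeg HN x Z sX sY.
have LXY := sym_lie_hor HB Bnondeg HN x X Y Z.
have LYZ := sym_lie_hor HB Bnondeg HN x Y Z X.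
have LZX := sym_lie_hor HB Bnondeg HN x Z X Y.
have dE := ext_deriv_omega HB x (hor B X x) (hor B Y x) (hor B Z x).
apply: etrans (congr2 +%R (congr2 +%R JX JY) JZ) _.
apply: etrans _ (esym (congr2 +%R (congr2 +%R (congr2 +%R dE LXY) LYZ) LZX)).
exact: regroup.
Qed.
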